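(* Let $A$ and $B$ be $C^*$-algebras and let ${}_AX_B$ be an $A$--$B$ imprimitivity bimodule. Let $\pi\in\hat B$ and let $(\pi_\alpha)$ be a net in $\hat B$ such that $\pi$ is a cluster point of $(\pi_\alpha)$. Then $$M_L(\pi,(\pi_\alpha))=M_L(\mathrm{Ind}\,\pi,(\mathrm{Ind}\,\pi_\alpha)),$$ where the left-hand side is computed in $\hat B$ and the right-hand side in $\hat A$.
   Context: Imprimitivity bimodules: an $A$--$B$ imprimitivity bimodule ${}_AX_B$ is an $A$--$B$ bimodule which is a full left Hilbert $A$-module (inner product ${}_A\langle\cdot,\cdot\rangle$) and a full right Hilbert $B$-module (inner product $\langle\cdot,\cdot\rangle_B$), such that $A$ acts by adjointable operators on $X_B$, $B$ acts by adjointable operators on ${}_AX$, and ${}_A\langle x,y\rangle\cdot z=x\cdot\langle y,z\rangle_B$. For a representation $\pi$ of $B$ on $H$, $\mathrm{Ind}\,\pi$ is the representation of $A$ on $X\otimes_BH$ (the Hilbert space completion of the balanced tensor product with $(x\otimes h\,|\,y\otimes k)=(\pi(\langle y,x\rangle_B)h\,|\,k)$) given by $\mathrm{Ind}\,\pi(a)(x\otimes h)=(a\cdot x)\otimes h$. Induction respects unitary equivalence and irreducibility and induces a homeomorphism of the spectrum $\hat B$ onto $\hat A$. Lower multiplicity relative to a net (Archbold, Archbold--Spielberg): let $D$ be a $C^*$-algebra, $\pi\in\hat D$, and let $\varphi$ be a pure state of $D$ associated with $\pi$ (a vector state of $\pi$). Let $\mathcal N$ be the set of weak*-open neighbourhoods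 of $0$ in $D^*$. For $N\in\mathcal N$ and $\sigma\in\hat D$ put $\mathrm{Vec}(\sigma,\varphi,N)=\{\eta\in H_\sigma:\|\eta\|=1,\ (\sigma(\cdot)\eta\,|\,\eta)\in\varphi+N\}$, and let $d(\sigma,\varphi,N)\in\{0,1,2,\dots\}\cup\{\infty\}$ be the supremum of the cardinalities of finite orthonormal subsets of $\mathrm{Vec}(\sigma,\varphi,N)$ (equal to $0$ if this set is empty). For a net $(\pi_\alpha)$ in $\hat D$, $$M_L(\pi,(\pi_\alpha))=\inf_{N\in\mathcal N}\ \liminf_\alpha d(\pi_\alpha,\varphi,N),$$ which is independent of the choice of $\varphi$. *)

(* Defs.v *)
(* MathComp / MathComp-Analysis. *)
From HB Require Import structures.
From mathcomp Require Import all_boot all_order all_algebra.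
From mathcomp Require Import all_classical all_reals all_analysis.
From mathcomp Require Import sesquilinear complex.

Set Implicit Arguments.
Unset Strict Implicit.
Unset Printing Implicit Defensive.

Import Order.TTheory GRing.Theory Num.Theory.
Import numFieldNormedType.Exports.

Local Open Scope classical_set_scope.
Local Open Scope ring_scope.
Local Open Scope complex_scope.

(* Complex C*-algebras. They need not be unital, so the product is a separate
   operation and not the one of a MathComp ring (which has a unit). *)
HB.mixin Record isCStar (R : realType) A & CompleteNormedModule R[i] A := {
  cmul : {bilinear A -> A -> A} ;
  cstar : A -> A ;
  cmulA : forall a b c : A, cmul a (cmul b c) = cmul (cmul a b) c ;
  cstarK : forall a, cstar (cstar a) = a ;
  cstarD : forall a b, cstar (a + b) = cstar a + cstar b ;
  cstarZ : forall (l : R[i]) a, cstar (l *: a) = Num.conj l *: cstar a ;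
  cstarM : forall a b, cstar (cmul a b) = cmul (cstar b) (cstar a) ;
  cnorm_mul : forall a b, `|cmul a b| <= `|a| * `|b| ;
  cnorm_star : forall a, `|cmul (cstar a) a| = `|a| ^+ 2
}.

#[short(type="cstarType")]
HB.structure Definition CStar (R : realType) :=
  {A of CompleteNormedModule R[i] A & isCStar R A}.

(* Inner products are linear in the first variable. *)
HB.mixin Record isHilbert (R : realType) H & CompleteNormedModule R[i] H := {
  ip : {dot H for (@Num.conj R[i])} ;
  ip_norm : forall h : H, `|h| ^+ 2 = ip h h
}.

#[short(type="hilbertType")]
HB.structure Definition Hilbert (R : realType) :=
  {H of CompleteNormedModule R[i] H & isHilbert R H}.

Definition lin_span (K : nzRingType) (V : lmodType K) (S : set V) : set V :=
  [set v | exists n (c : 'I_n -> K) (s : 'I_n -> V),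
     (forall i, S (s i)) /\ v = \sum_(i < n) c i *: s i].

Definition closed_subspace (K : numFieldType) (V : normedModType K)
    (S : set V) : Prop :=
  [/\ closed S, S 0 & forall (c : K) u v, S u -> S v -> S (c *: u + v)].

Section CStarAlgebras.
Variables (R : realType) (D : cstarType R).

Definition cpositive (a : D) : Prop := exists c : D, a = cmul (cstar c) c.

Definition closed_ideal (J : set D) : Prop :=
  closed_subspace J /\
  forall a b : D, J a -> J (cmul a b) /\ J (cmul b a).

(* The dual D^*, as a subspace of the space of all functions D -> C with the
   topology of pointwise convergence: the (subspace) topology that the library
   puts on this type is the weak* topology. *)
Definition dual_set : set {ptws D -> R[i]^o} :=
  [set f : D -> R[i]^o | linear f /\ continuous f].
Definition dual := set_type dual_set.
Definition dual_app (f : dual) : D -> R[i] := val f.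

(* Representations of D: *-homomorphisms from D to the bounded operators on
   a Hilbert space. *)
Record rep := Rep {
  rep_space : hilbertType R ;
  rep_act : {bilinear D -> rep_space -> rep_space} ;
  rep_bounded : forall a, continuous (rep_act a) ;
  rep_mul : forall a b h, rep_act (cmul a b) h = rep_act a (rep_act b h) ;
  rep_star : forall a h k, ip (rep_act a h) k = ip h (rep_act (cstar a) k)
}.

Definition irreducible (s : rep) : Prop :=
  (exists a h, rep_act s a h != 0) /\
  forall V : set (rep_space s), closed_subspace V ->
    (forall a h, V h -> V (rep_act s a h)) -> V = [set 0] \/ V = setT.

(* Points of the spectrum are given by representatives of the unitary
   equivalence classes of irreducible representations. *)
Record irrep := Irrep { irrep_rep :> rep ; irrepP : irreducible irrep_rep }.

(* The hull-kernel topology of the spectrum. The open sets are plain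
   predicates because [irrep] is too large to be the carrier of a library
   [topologicalType]. *)
Definition spectrum_open (U : irrep -> Prop) : Prop :=
  exists2 J : set D, closed_ideal J &
    forall s : irrep, U s <-> ~ (forall a, J a -> forall h, rep_act s a h = 0).

End CStarAlgebras.

Coercion dual_app : dual >-> Funclass.

Definition directed (I : Type) (le : I -> I -> Prop) : Prop :=
  [/\ inhabited I, forall i, le i i,
      forall i j k, le i j -> le j k -> le i k &
      forall i j, exists k, le i k /\ le j k].

Definition spectrum_cluster (R : realType) (D : cstarType R)
    (I : Type) (le : I -> I -> Prop) (s_ : I -> irrep D) (s : irrep D) : Prop :=
  forall U, spectrum_open U -> U s -> forall i, exists2 j, le i j & U (s_ j).

Section Modules.
Variables (R : realType) (A B : cstarType R).

Definition norm_complete (X : zmodType) (nrm : X -> R[i]) : Prop :=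
  forall u : nat -> X,
    (forall e : R[i], 0 < e -> exists N : nat,
       forall m n, (N <= m)%N -> (N <= n)%N -> nrm (u m - u n) < e) ->
    exists l, forall e : R[i], 0 < e -> exists N : nat,
       forall n, (N <= n)%N -> nrm (u n - l) < e.

Record right_hilbert_module (X : lmodType R[i])
    (act : {bilinear X -> B -> X}) (rip : X -> X -> B) : Prop := {
  ract_mul : forall x b c, act x (cmul b c) = act (act x b) c ;
  rip_linear : forall x, linear (rip x) ;
  rip_act : forall x y b, rip x (act y b) = cmul (rip x y) b ;
  rip_star : forall x y, cstar (rip x y) = rip y x ;
  rip_pos : forall x, cpositive (rip x x) ;
  rip_def : forall x, rip x x = 0 -> x = 0 ;
  rip_complete : norm_complete (fun x => sqrtC `|rip x x|)
}.

Record left_hilbert_module (X : lmodType R[i])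
    (act : {bilinear A -> X -> X}) (lip : X -> X -> A) : Prop := {
  lact_mul : forall a c x, act (cmul a c) x = act a (act c x) ;
  lip_linear : forall y, linear (lip^~ y) ;
  lip_act : forall a x y, lip (act a x) y = cmul a (lip x y) ;
  lip_star : forall x y, cstar (lip x y) = lip y x ;
  lip_pos : forall x, cpositive (lip x x) ;
  lip_def : forall x, lip x x = 0 -> x = 0 ;
  lip_complete : norm_complete (fun x => sqrtC `|lip x x|)
}.

Definition full (D : cstarType R) (X : Type) (f : X -> X -> D) : Prop :=
  closure (lin_span [set f p.1 p.2 | p in [set: X * X]]) = setT.

Definition adjointable (D : cstarType R) (X : Type) (f : X -> X -> D)
    (T : X -> X) : Prop :=
  exists S : X -> X, forall x y, f (T x) y = f x (S y).

(* The two inner products give two norms on X; their equality is a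
   consequence of the axioms and is not imposed. *)
Record imprimitivity_bimodule := ImprimitivityBimodule {
  bim_space : lmodType R[i] ;
  lact : {bilinear A -> bim_space -> bim_space} ;
  ract : {bilinear bim_space -> B -> bim_space} ;
  lip : bim_space -> bim_space -> A ;
  rip : bim_space -> bim_space -> B ;
  bim_assoc : forall a x b, ract (lact a x) b = lact a (ract x b) ;
  bim_left : left_hilbert_module lact lip ;
  bim_right : right_hilbert_module ract rip ;
  bim_left_full : full lip ;
  bim_right_full : full rip ;
  lact_adjointable : forall a, adjointable rip (lact a) ;
  ract_adjointable : forall b, adjointable lip (ract^~ b) ;
  bim_compat : forall x y z, lact (lip x y) z = ract x (rip y z)
}.

(* [induced_rep X s] is the type of models of Ind s: the Hilbert space is a
   completion of the balanced tensor product, i.e. it contains the elementary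
   tensors [tens x h] with the prescribed inner products, and their linear span
   is dense. This determines [ind_rep] up to a canonical unitary equivalence. *)
Record induced_rep (X : imprimitivity_bimodule) (s : rep B) := InducedRep {
  ind_rep :> rep A ;
  tens : {bilinear bim_space X -> rep_space s -> rep_space ind_rep} ;
  tens_balanced : forall x b h, tens (ract X x b) h = tens x (rep_act s b h) ;
  tens_ip : forall x h y k,
    ip (tens x h) (tens y k) = ip (rep_act s (rip y x) h) k ;
  tens_dense : closure (lin_span
    [set tens p.1 p.2 | p in [set: bim_space X * rep_space s]]) = setT ;
  ind_act : forall a x h, rep_act ind_rep a (tens x h) = tens (lact X a x) h
}.

End Modules.

Section LowerMultiplicity.
Variables (R : realType) (D : cstarType R).

Definition vector_state (s : rep D) (phi : dual D) : Prop :=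
  exists2 xi : rep_space s, `|xi| = 1 &
    forall a, phi a = ip (rep_act s a xi) xi.

Definition weakstar_nbhs0 (N : set (dual D)) : Prop :=
  open N /\ exists2 z : dual D, N z & forall a, z a = 0.

Definition Vec (s : rep D) (phi : dual D) (N : set (dual D)) :
    set (rep_space s) :=
  [set eta | `|eta| = 1 /\
     exists2 nu : dual D, N nu &
       forall a, ip (rep_act s a eta) eta = phi a + nu a].

Definition orthonormal_family (H : hilbertType R) (n : nat) (e : 'I_n -> H) :
    Prop :=
  forall i j, ip (e i) (e j) = (i == j)%:R.

Definition dVec (s : rep D) (phi : dual D) (N : set (dual D)) : \bar R :=
  ereal_sup [set (n%:R)%:E | n in [set n : nat |
    exists2 e : 'I_n -> rep_space s, orthonormal_family e &
      forall i, Vec phi N (e i)]].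

Definition net_liminf (I : Type) (le : I -> I -> Prop) (f : I -> \bar R) :
    \bar R :=
  ereal_sup [set ereal_inf [set f j | j in [set j | le i j]] | i in [set: I]].

(* M_L(pi, (s_i)), computed with the pure state phi associated with pi. *)
Definition lower_multiplicity (phi : dual D)
    (I : Type) (le : I -> I -> Prop) (s_ : I -> rep D) : \bar R :=
  ereal_inf [set net_liminf le (fun i => dVec (s_ i) phi N) |
    N in weakstar_nbhs0].

End LowerMultiplicity.

(* Main.v *)
(* For a unit vector [xi] of an irreducible representation, the vector state
   [phi] of [xi] is pure. A compactness argument then shows that, for any [b],
   orthogonal unit vectors [x], [y] of an arbitrary representation [t] whose
   vector states are close enough to [phi] satisfy [(t(b) x | y) ~ 0]: a limit
   of the functionals [(t(.) x | y)] exhibits [phi] as a midpoint of states.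

   Let [zeta] be a unit vector of [Ind pi]. Since [Ind pi] is irreducible,
   [zeta] is close to [x (x) xi] for some [x] in [X]. If [e_1, ..., e_n] are
   orthonormal in [t] with states close to [phi], then the vectors
   [x (x) e_i] of [Ind t] have Gram matrix [(t(<x, x>) e_i | e_j)], which is
   close to the identity, and states close to that of [zeta]; they can hence be
   moved to an orthonormal family with states close to that of [zeta]. The same
   argument with the adjoints of the operators [h |-> x (x) h] goes back from
   [Ind t] to [t]. So, for each [n], having [n] orthonormal vectors with states
   near the given one transfers between [t] and [Ind t], uniformly in [t]. *)
Require Import Defs.
From mathcomp Require Import all_boot all_order all_algebra.
From mathcomp Require Import all_classical all_reals all_analysis.
From mathcomp Require Import sesquilinear complex.
From mathcomp Require Import ring lra.

Set Implicit Arguments.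
Unset Strict Implicit.
Unset Printing Implicit Defensive.

Import Order.TTheory GRing.Theory Num.Theory.
Import numFieldNormedType.Exports.

Local Open Scope classical_set_scope.
Local Open Scope ring_scope.
Local Open Scope complex_scope.

(** * Real-valued norms *)

(** No functional calculus is used. One square root construction, for a contraction of a Banach
    space, serves twice. Applied to left multiplication by [b^* b] in the algebra, it shows that
    representations are contractive. Applied to [1 - S^2] on a Hilbert space, it gives [|S|] and
    then Schur's lemma, on which purity rests. Since the algebra may lack a unit, positivity and
    norm at most 1 of a functional [f] are expressed together by [|f a|^2 <= f (a^* a)], which is
    stable under pointwise limits. The estimates must be uniform over all representations [t].
    Compactness is therefore applied to functionals: [(t(.) x | y)] is bounded by the norm at each
    element, whatever [t] is, so an ultrafilter gives pointwise limits. The way back from [Ind t] to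
    [t] is the same argument because the adjoints of [h |-> x (x) h] satisfy the same relations,
    with A and B exchanged and X replaced by its conjugate. *)

Section RealNorm.
Variable R : realType.
Implicit Types z w : R[i].

(** The norm over [R[i]] is itself [R[i]]-valued; its real part lives in the totally ordered field
    [R], where the estimates take place. *)
Definition cmod z : R := complex.Re `|z|.

Lemma cmodE z : `|z| = (cmod z)%:C.
Proof. by rewrite /cmod normc_def. Qed.

Lemma cmod_ge0 z : 0 <= cmod z.
Proof. by rewrite -ler0c -cmodE. Qed.

Lemma cmod0_eq z : cmod z = 0 -> z = 0.
Proof. by move=> z0; apply/normr0_eq0; rewrite cmodE z0. Qed.

Lemma cmod0 : cmod 0 = 0.
Proof. by rewrite /cmod normr0. Qed.

Lemma ltr0c (x : R) : (0 < x%:C) = (0 < x).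
Proof. exact: (ltcR 0 x). Qed.

Lemma cmodD z w : cmod (z + w) <= cmod z + cmod w.
Proof. by rewrite -lecR rmorphD -!cmodE ler_normD. Qed.

Lemma cmodM z w : cmod (z * w) = cmod z * cmod w.
Proof. by apply: complexI; rewrite rmorphM -!cmodE normrM. Qed.

Lemma cmodN z : cmod (- z) = cmod z.
Proof. by rewrite /cmod normrN. Qed.

Lemma cmodJ z : cmod (Num.conj z) = cmod z.
Proof. by rewrite /cmod norm_conjC. Qed.

Lemma cmodR (x : R) : cmod x%:C = `|x|.
Proof. by rewrite /cmod normc_def /= expr0n addr0 sqrtr_sqr. Qed.

Lemma cmod_sqr z : cmod z ^+ 2 = complex.Re z ^+ 2 + complex.Im z ^+ 2.
Proof.
by rewrite /cmod normc_def /= sqr_sqrtr // addr_ge0 // sqr_ge0.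
Qed.

Lemma mulJE z : z * Num.conj z = (cmod z ^+ 2)%:C.
Proof. by rewrite -normCK cmodE rmorphXn. Qed.

Lemma Re_le_cmod z : `|complex.Re z| <= cmod z.
Proof. by rewrite -lecR -cmodE normc_ge_Re. Qed.

Lemma Im_le_cmod z : `|complex.Im z| <= cmod z.
Proof.
rewrite -[leLHS](ger0_norm (normr_ge0 _)) -(ger0_norm (cmod_ge0 z)).
rewrite -ler_sqr ?nnegrE ?normr_ge0 //.
by rewrite !normr_id !real_normK ?num_real // cmod_sqr lerDr sqr_ge0.
Qed.

Lemma ge0_ReE z : 0 <= z -> z = (complex.Re z)%:C.
Proof. by case: z => a b; rewrite lecE /= => /andP[/eqP-> _]. Qed.

Variable V : normedModType R[i].
Implicit Types u v : V.

Definition nrm v : R := complex.Re `|v|.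

Lemma nrmE v : `|v| = (nrm v)%:C.
Proof. exact: ge0_ReE. Qed.

Lemma nrm_ge0 v : 0 <= nrm v.
Proof. by rewrite -ler0c -nrmE. Qed.

Lemma nrm0_eq v : nrm v = 0 -> v = 0.
Proof. by move=> v0; apply/normr0_eq0; rewrite nrmE v0. Qed.

Lemma nrm0 : nrm 0 = 0.
Proof. by rewrite /nrm normr0. Qed.

Lemma nrmD u v : nrm (u + v) <= nrm u + nrm v.
Proof. by rewrite -lecR rmorphD /= -!nrmE ler_normD. Qed.

Lemma nrmZ z v : nrm (z *: v) = cmod z * nrm v.
Proof. by apply: complexI; rewrite rmorphM /= -cmodE -!nrmE normrZ. Qed.

Lemma nrmN v : nrm (- v) = nrm v.
Proof. by rewrite /nrm normrN. Qed.

Lemma nrmBC u v : nrm (u - v) = nrm (v - u).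
Proof. by rewrite /nrm distrC. Qed.

Lemma nrm_tri u v (w : V) : nrm (u - w) <= nrm (u - v) + nrm (v - w).
Proof. by have := nrmD (u - v) (v - w); rewrite addrA subrK. Qed.

Lemma nrmB u v : nrm (u - v) <= nrm u + nrm v.
Proof. by rewrite -[nrm v]nrmN nrmD. Qed.

Lemma nrm_leB u v : nrm u <= nrm v + nrm (u - v).
Proof. by rewrite -[X in nrm X <= _](subrK v u) addrC nrmD. Qed.

Lemma nrm_small0 v : (forall e : R, 0 < e -> nrm v <= e) -> v = 0.
Proof.
move=> h; apply: nrm0_eq; apply/eqP; rewrite eq_le nrm_ge0 andbT.
by apply/ler_addgt0Pr => e e0; rewrite add0r h.
Qed.

Lemma closure_nrmP (S : set V) v :
  closure S v <-> forall e : R, 0 < e -> exists2 u, S u & nrm (v - u) < e.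
Proof.
split=> [cS e e0|h U].
  have ee : 0 < e%:C by rewrite ltr0c.
  have [u [Su]] := cS _ (nbhsx_ballx v _ ee).
  by rewrite -ball_normE /= nrmE ltcR => ?; exists u.
move=> /nbhs_ballP[e /= e0 eU].
have eE := ge0_ReE (ltW e0).
have [|u Su uv] := h (complex.Re e); first by rewrite -ltr0c -eE.
exists u; split => //; apply: eU.
by rewrite -ball_normE /= nrmE eE ltcR.
Qed.

Lemma closed_nrmP (S : set V) :
  closed S <-> forall v,
    (forall e : R, 0 < e -> exists2 u, S u & nrm (v - u) < e) -> S v.
Proof.
split=> [/closure_id cS v /closure_nrmP|h]; first by rewrite -cS.
rewrite closure_id; apply/seteqP; split; first exact: subset_closure.
by move=> v /closure_nrmP/h.
Qed.

End RealNorm.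

Lemma cauchy_converges (R : realType) (V : completeNormedModType R[i])
    (u : nat -> V) :
  (forall e : R, 0 < e -> exists N, forall m n, (N <= m)%N -> (N <= n)%N ->
     nrm (u m - u n) < e) ->
  exists l, forall e : R, 0 < e -> exists N, forall n, (N <= n)%N ->
     nrm (l - u n) < e.
Proof.
move=> h; have : cvg (u @ \oo).
  apply/cauchy_cvgP/cauchy_exP => e e0.
  have eE := ge0_ReE (ltW e0).
  have [|N hN] := h (complex.Re e); first by rewrite -ltr0c -eE.
  exists (u N), N => // n /= Nn; rewrite -ball_normE /= nrmE eE ltcR.
  exact: hN.
move=> /cvg_ex[l ul]; exists l => e e0.
have ee : 0 < e%:C by rewrite ltr0c.
move: ul => /cvgrPdist_lt/(_ _ ee)[N _ hN].
by exists N => n Nn; have := hN n Nn; rewrite /= nrmE ltcR.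
Qed.

(** * Inner products *)

Lemma eq_ReIm (R : realType) (z w : R[i]) :
  complex.Re z = complex.Re w -> complex.Im z = complex.Im w -> z = w.
Proof. by case: z w => a b [c d] /= -> ->. Qed.

Lemma ReD (R : realType) (z w : R[i]) :
  complex.Re (z + w) = complex.Re z + complex.Re w.
Proof. by case: z w => a b [c d]. Qed.

Lemma ImD (R : realType) (z w : R[i]) :
  complex.Im (z + w) = complex.Im z + complex.Im w.
Proof. by case: z w => a b [c d]. Qed.

Lemma ReM (R : realType) (z w : R[i]) :
  complex.Re (z * w)
  = complex.Re z * complex.Re w - complex.Im z * complex.Im w.
Proof. by case: z w => a b [c d]. Qed.

Lemma ImM (R : realType) (z w : R[i]) :
  complex.Im (z * w)
  = complex.Re z * complex.Im w + complex.Im z * complex.Re w.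
Proof. by case: z w => a b [c d]. Qed.

Lemma ReN (R : realType) (z : R[i]) : complex.Re (- z) = - complex.Re z.
Proof. by case: z. Qed.

Lemma ImN (R : realType) (z : R[i]) : complex.Im (- z) = - complex.Im z.
Proof. by case: z. Qed.

Lemma ReJ (R : realType) (z : R[i]) : complex.Re (Num.conj z) = complex.Re z.
Proof. by case: z. Qed.

Lemma ImJ (R : realType) (z : R[i]) : complex.Im (Num.conj z) = - complex.Im z.
Proof. by case: z. Qed.

Definition ReImE := (ReD, ImD, ReM, ImM, ReN, ImN, ReJ, ImJ).

Section PositiveForms.
Variables (R : realType) (V : lmodType R[i]).

Record positive_form (s : V -> V -> R[i]) : Prop := PositiveForm {
  pformPl : forall c u v w, s (c *: u + v) w = c * s u w + s v w ;
  pformPr : forall c u v w, s w (c *: u + v) = Num.conj c * s w u + s w v ;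
  pform_ge0 : forall u, 0 <= s u u }.

Variables (s : V -> V -> R[i]) (sP : positive_form s).

Lemma pformDl u v w : s (u + v) w = s u w + s v w.
Proof. by have := pformPl sP 1 u v w; rewrite scale1r mul1r. Qed.

Lemma pformDr u v w : s w (u + v) = s w u + s w v.
Proof. by have := pformPr sP 1 u v w; rewrite scale1r rmorph1 mul1r. Qed.

(** Positivity makes every [s w w] real: [w = v + u] gives the imaginary parts, [w = 'i v + u] the
    real parts. *)
Lemma pform_hermitian u v : s u v = Num.conj (s v u).
Proof.
have im0 w : complex.Im (s w w) = 0 by apply: ger0_Im; exact: pform_ge0.
have := im0 ('i *: v + u); have := im0 (v + u); move: (im0 u) (im0 v).
rewrite !(pformPl sP) !(pformPr sP) !pformDl !pformDr.
rewrite !ReImE /= => -> -> h1 h2.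
apply: eq_ReIm; rewrite !ReImE; lra.
Qed.

Lemma pform_cauchy_schwarz u v :
  cmod (s u v) ^+ 2 <= complex.Re (s u u) * complex.Re (s v v).
Proof.
have re_ge0 w : 0 <= complex.Re (s w w).
  by rewrite -ler0c -ge0_ReE; exact: pform_ge0.
(* The form at [u - t s(u,v) v]; the factor [s(u,v)] makes the cross terms real. *)
have key (t : R) : 0 <= complex.Re (s u u) - 2 * t * cmod (s u v) ^+ 2
    + t ^+ 2 * cmod (s u v) ^+ 2 * complex.Re (s v v).
  have := re_ge0 ((- (t%:C * s u v)) *: v + u).
  rewrite !(pformPl sP) !(pformPr sP) (pform_hermitian v u) cmod_sqr.
  rewrite (ge0_ReE (pform_ge0 sP v)) !ReImE /=.
  move=> /le_trans; apply; rewrite le_eqVlt; apply/orP; left; apply/eqP; ring.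
move: (re_ge0 v) key.
move: (cmod _ ^+ 2) (complex.Re (s u u)) (complex.Re (s v v)) => B p q q0 key.
have [q_gt0|q_le0] := ltP 0 q.
  have := key q^-1.
  have -> : p - 2 * q^-1 * B + q^-1 ^+ 2 * B * q = p - B / q.
    by field; rewrite gt_eqF.
  by rewrite subr_ge0 ler_pdivrMr.
have {q_le0 q0}q0 : q = 0 by apply/eqP; rewrite eq_le q_le0.
rewrite q0 mulr0; have [//|B_gt0] := leP B 0.
(* When [q = 0] the bound is affine in [t], and this [t] turns it into [0 <= p - (p + 1)]. *)
have := key ((p + 1) / (2 * B)).
rewrite q0 mulr0 addr0.
have -> : 2 * ((p + 1) / (2 * B)) * B = p + 1.
  by field; rewrite gt_eqF.
lra.
Qed.

End PositiveForms.

Section HilbertSpaces.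
Variables (R : realType) (H : hilbertType R).
Implicit Types h k : H.

Lemma ipPl c h k (l : H) : ip (c *: h + k) l = c * ip h l + ip k l.
Proof. by rewrite linearDl linearZl_LR. Qed.

Lemma ipPr c h k (l : H) : ip l (c *: h + k) = Num.conj c * ip l h + ip l k.
Proof. by rewrite linearPr. Qed.

Lemma ip_nrm h : ip h h = (nrm h ^+ 2)%:C.
Proof. by rewrite -ip_norm nrmE rmorphXn. Qed.

Lemma ip_positive : positive_form (fun h k => ip h k).
Proof.
split=> [? ? ? ?|? ? ? ?|h]; [exact: ipPl|exact: ipPr|].
by rewrite ip_nrm ler0c sqr_ge0.
Qed.

Lemma ipDl h k (l : H) : ip (h + k) l = ip h l + ip k l.
Proof. exact: linearDl. Qed.

Lemma ipDr h k (l : H) : ip l (h + k) = ip l h + ip l k.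
Proof. exact: linearDr. Qed.

Lemma ipBl h k (l : H) : ip (h - k) l = ip h l - ip k l.
Proof. exact: linearBl. Qed.

Lemma ipBr h k (l : H) : ip l (h - k) = ip l h - ip l k.
Proof. exact: linearBr. Qed.

Lemma ipZl c h k : ip (c *: h) k = c * ip h k.
Proof. exact: linearZl_LR. Qed.

Lemma ipZr c h k : ip h (c *: k) = Num.conj c * ip h k.
Proof. exact: linearZr_LR. Qed.

Lemma ip0l h : ip 0 h = 0.
Proof. exact: linear0l. Qed.

Lemma ip0r h : ip h 0 = 0.
Proof. exact: linear0r. Qed.

Lemma ipC h k : ip h k = Num.conj (ip k h).
Proof. exact: (pform_hermitian ip_positive). Qed.

Lemma cauchy_schwarz h k : cmod (ip h k) <= nrm h * nrm k.
Proof.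
have := pform_cauchy_schwarz ip_positive h k.
rewrite !ip_nrm /= -exprMn ler_sqr ?nnegrE ?cmod_ge0 //.
by rewrite mulr_ge0 ?nrm_ge0.
Qed.

Lemma nrm_sqr h : nrm h ^+ 2 = complex.Re (ip h h).
Proof. by rewrite ip_nrm. Qed.

Lemma nrm_le_ip h (C : R) : 0 <= C -> 
  (forall k, cmod (ip h k) <= C * nrm k) -> nrm h <= C.
Proof.
move=> C0 /(_ h); rewrite ip_nrm cmodR ger0_norm ?sqr_ge0 // expr2.
have [->|h0] := eqVneq (nrm h) 0; first by [].
by rewrite ler_pM2r // lt_neqAle eq_sym h0 nrm_ge0.
Qed.

Lemma ip_ext h k : (forall l, ip h l = ip k l) -> h = k.
Proof.
move=> hk; apply/eqP; rewrite -subr_eq0; apply/eqP; apply: nrm0_eq.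
apply/eqP; rewrite -sqrf_eq0; apply/eqP; rewrite nrm_sqr ipBl hk subrr //.
Qed.

Lemma nrm_sqrD h k :
  nrm (h + k) ^+ 2 = nrm h ^+ 2 + 2 * complex.Re (ip h k) + nrm k ^+ 2.
Proof.
rewrite !nrm_sqr !(ipDl, ipDr) !ReImE (ipC k h) !ReImE; ring.
Qed.

End HilbertSpaces.

Lemma invn_small (R : realType) (e : R) : 0 < e ->
  exists N, forall n, (N <= n)%N -> n.+1%:R^-1 < e.
Proof.
move=> e0; exists (Num.bound e^-1) => n Nn.
rewrite invf_plt ?posrE ?ltr0n //.
apply: lt_le_trans (archi_boundP _) _; first by rewrite invr_ge0 ltW.
by rewrite ler_nat (leq_trans Nn).
Qed.

Lemma linear_mapD (K : nzRingType) (V W : lmodType K) (f : V -> W) :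
  linear f -> forall u v, f (u + v) = f u + f v.
Proof. by move=> fl u v; have := fl 1 u v; rewrite !scale1r. Qed.

Lemma linear_map0 (K : nzRingType) (V W : lmodType K) (f : V -> W) :
  linear f -> f 0 = 0.
Proof.
move=> fl; have := linear_mapD fl 0 0.
by rewrite addr0 => /eqP; rewrite eq_sym -subr_eq0 addrK => /eqP.
Qed.

Lemma linear_mapZ (K : nzRingType) (V W : lmodType K) (f : V -> W) :
  linear f -> forall c v, f (c *: v) = c *: f v.
Proof.
by move=> fl c v; have := fl c v 0; rewrite !addr0 linear_map0 // addr0.
Qed.

Lemma linear_mapN (K : nzRingType) (V W : lmodType K) (f : V -> W) :
  linear f -> forall v, f (- v) = - f v.
Proof. by move=> fl v; rewrite -scaleN1r linear_mapZ // scaleN1r. Qed.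

Lemma linear_mapB (K : nzRingType) (V W : lmodType K) (f : V -> W) :
  linear f -> forall u v, f (u - v) = f u - f v.
Proof. by move=> fl u v; rewrite linear_mapD // linear_mapN. Qed.

(* The functional [l] need not be defined on the closure of the range of [p]:
   a minimizing sequence of [|p v|^2 - 2 Re (l v)] is mapped by [p] to a Cauchy
   sequence whose limit represents [l]. *)
Lemma riesz (R : realType) (H : hilbertType R) (V : lmodType R[i])
    (p : V -> H) (l : V -> R[i]) (C : R) :
  linear p -> (forall c u v, l (c *: u + v) = c * l u + l v) ->
  (forall v, cmod (l v) <= C * nrm (p v)) ->
  exists k, forall v, l v = ip (p v) k.
Proof.
move=> pl ll lC.
pose J v := nrm (p v) ^+ 2 - 2 * complex.Re (l v).
have JD v w (t : R) : J (t%:C *: w + v) = J v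
    + 2 * t * (complex.Re (ip (p v) (p w)) - complex.Re (l w))
    + t ^+ 2 * nrm (p w) ^+ 2.
  rewrite /J pl ll nrm_sqrD nrmZ cmodR exprMn ipZl (ipC (p w)).
  rewrite real_normK ?num_real // !ReImE /=; ring.
have J_ge v : - C ^+ 2 <= J v.
  have := le_trans (ler_norm _) (le_trans (Re_le_cmod _) (lC v)).
  rewrite /J; have := sqr_ge0 (nrm (p v) - C); lra.
pose S := range J.
have S_inf : has_inf S.
  by split; [exists (J 0), 0|exists (- C ^+ 2) => _ [v _ <-]].
have mJ v : inf S <= J v by apply: ge_inf => //; [case: S_inf|exists v].
have /choice[u uJ] (n : nat) : exists v, J v < inf S + n.+1%:R^-1.
  have n0 : 0 < n.+1%:R^-1 :> R by rewrite invr_gt0 ltr0n.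
  by have [_ [v _ <-] vn] := inf_adherent n0 S_inf; exists v.
(* Parallelogram identity: [J] at the midpoint of [u m] and [u n] is the mean of the two values
   minus a quarter of this square, and is at least the infimum. *)
have uC m n : nrm (p (u m) - p (u n)) ^+ 2 <= 2 * (m.+1%:R^-1 + n.+1%:R^-1).
  have := mJ ((2^-1)%:C *: (u m - u n) + u n).
  have := uJ m; have := uJ n.
  have -> : J (u m) = J (1%:C *: (u m - u n) + u n) by rewrite scale1r subrK.
  rewrite !JD (linear_mapB pl).
  move: (J _) (nrm _ ^+ 2) (_ - complex.Re _) (inf S) m.+1%:R^-1 n.+1%:R^-1.
  by move=> *; lra.
have [|k uk] := @cauchy_converges _ _ (fun n => p (u n)).
  move=> e e0; have e20 : 0 < e ^+ 2 / 4 by rewrite divr_gt0 ?exprn_gt0.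
  have [N hN] := invn_small e20; exists N => m n /hN m_lt /hN n_lt.
  rewrite -ltr_sqr ?nnegrE ?nrm_ge0 ?ltW //.
  have := uC m n; move: m.+1%:R^-1 n.+1%:R^-1 m_lt n_lt => a b; lra.
exists k.
have re w : complex.Re (l w) = complex.Re (ip k (p w)).
  pose D := complex.Re (ip k (p w)) - complex.Re (l w).
  (* First variation of [J] in the direction [w]. Half of [d] pays for replacing [p (u n)] by its
     limit [k], the other half for the excess of [J (u n)] over the infimum. *)
  have key (t d : R) : 0 < d -> 0 <= d + 2 * t * D + t ^+ 2 * nrm (p w) ^+ 2.
    move=> d0.
    have e0 : 0 < d / 2 / (2 * `|t| * nrm (p w) + 1).
      rewrite !divr_gt0 // ltr_wpDl // !mulr_ge0 ?nrm_ge0 //.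
    have [N1 hN1] := uk _ e0.
    have [|N2 hN2] := @invn_small _ (d / 2); first by rewrite divr_gt0.
    have := hN1 _ (leq_maxl N1 N2); have := hN2 _ (leq_maxr N1 N2).
    move: (maxn N1 N2) => n n1 n2.
    have := mJ (t%:C *: w + u n); rewrite JD; have := uJ n.
    have : 2 * t * (complex.Re (ip (p (u n)) (p w)) - complex.Re (ip k (p w)))
        <= d / 2.
      apply: le_trans (ler_norm _) _.
      rewrite -ReN -ReD -ipBl !normrM (ger0_norm (ler0n _ 2)).
      have CS := le_trans (Re_le_cmod _) (cauchy_schwarz (p (u n) - k) (p w)).
      have := ler_wpM2l (normr_ge0 t) CS; move: n2.
      rewrite (nrmBC k) ltr_pdivlMr; last first.
        by rewrite ltr_wpDl // !mulr_ge0 ?nrm_ge0 //.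
      have := nrm_ge0 (p (u n) - k).
      move: (nrm (p (u n) - k)) (nrm (p w)) `|t| `|complex.Re _| => a b c f.
      lra.
    rewrite /D; move: n.+1%:R^-1 n1 (J (u n)) => a n1 b; lra.
  apply/eqP; rewrite eq_sym -subr_eq0 -/D.
  have key' t : 0 <= 2 * t * D + t ^+ 2 * nrm (p w) ^+ 2.
    apply/ler_addgt0Pr => d d0.
    by have := key t d d0; rewrite -addrA addrC.
  have W0 := sqr_ge0 (nrm (p w)).
  move: (nrm _ ^+ 2) W0 key' => W W0 key'.
  (* The minimum would be at [- D / W]; the denominator [W + 1] also covers [W = 0]. *)
  have := key' (- D / (W + 1)).
  have W1 : 0 < W + 1 by lra.
  have -> : 2 * (- D / (W + 1)) * D + (- D / (W + 1)) ^+ 2 * W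
    = - (D ^+ 2 * (W + 2) / (W + 1) ^+ 2).
    by field; rewrite gt_eqF.
  rewrite oppr_ge0 pmulr_lle0 ?invr_gt0 ?exprn_gt0 //.
  rewrite pmulr_lle0; last by lra.
  by rewrite -sqrf_eq0 eq_le sqr_ge0 andbT.
move=> w; rewrite ipC; apply: eq_ReIm; rewrite !ReImE; first exact: re.
(* The real part at ['i w] is minus the imaginary part at [w]. *)
have := re ('i *: w).
rewrite (linear_mapZ pl) ipZr.
have -> : l ('i *: w) = 'i * l w.
  have l0 : l 0 = 0.
    have := ll 1 0 0; rewrite scaler0 addr0 mul1r => /eqP.
    by rewrite eq_sym -subr_eq0 addrK => /eqP.
  by have := ll 'i w 0; rewrite l0 !addr0.
rewrite !ReImE /=; lra.
Qed.

(** * Square roots of positive contractions *)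

Section SquareRoot.
Variables (R : realType) (V : completeNormedModType R[i]) (X : V -> V).
Hypotheses (Xl : linear X) (X1 : forall v, nrm (X v) <= nrm v).

(* Picard iteration for [Z = (X + Z^2) / 2], i.e. [(1 - Z)^2 = 1 - X]. Its
   increments are dominated by those of the scalar iteration [scalar_iter],
   whence the convergence, although the norm of [X] may be 1. *)
Fixpoint sqrt_iter n (v : V) : V :=
  if n is m.+1 then (2^-1)%:C *: (X v + sqrt_iter m (sqrt_iter m v)) else 0.

Fixpoint scalar_iter n : R :=
  if n is m.+1 then (1 + scalar_iter m ^+ 2) / 2 else 0.

Lemma scalar_iter_itv n : 0 <= scalar_iter n <= 1.
Proof. by elim: n => [|n] /=; [lra|nra]. Qed.

(** The increment after [z] is [(1 - z)^2 / 2]. *)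
Lemma scalar_iter_nondecreasing m n : (m <= n)%N ->
  scalar_iter m <= scalar_iter n.
Proof.
move=> mn; have st k : scalar_iter k <= scalar_iter k.+1.
  by rewrite /=; have := sqr_ge0 (1 - scalar_iter k); nra.
elim: n mn => [|n IH]; first by rewrite leqn0 => /eqP->.
by rewrite leq_eqVlt => /predU1P[->//|/IH /le_trans]; apply.
Qed.

Lemma sqrt_iter_linear n : linear (sqrt_iter n).
Proof.
elim: n => [|n IH] c u v /=; first by rewrite scaler0 addr0.
rewrite !IH Xl !scalerDr !scalerA.
by rewrite addrACA ![_ * c]mulrC.
Qed.

Lemma cmod_half : cmod (2^-1)%:C = 2^-1 :> R.
Proof. by rewrite cmodR ger0_norm // invr_ge0. Qed.

Lemma nrm_sqrt_iter n v : nrm (sqrt_iter n v) <= scalar_iter n * nrm v.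
Proof.
elim: n v => [|n IH] v /=; first by rewrite nrm0 mul0r.
rewrite nrmZ cmod_half.
have := nrmD (X v) (sqrt_iter n (sqrt_iter n v)).
have := ler_wpM2l (andP (scalar_iter_itv n)).1 (IH v).
have := IH (sqrt_iter n v); have := X1 v; lra.
Qed.

Lemma sqrt_iter_step n v :
  nrm (sqrt_iter n.+1 v - sqrt_iter n v)
  <= (scalar_iter n.+1 - scalar_iter n) * nrm v.
Proof.
elim: n v => [|n IH] v.
  rewrite /= subr0 addr0 nrmZ cmod_half; have := X1 v; lra.
set Z := sqrt_iter n; set Z' := sqrt_iter n.+1.
have -> : sqrt_iter n.+2 v - Z' v = (2^-1)%:C *: (Z' (Z' v) - Z (Z v)).
  rewrite [LHS]/= -/Z' -/Z -scalerBr; congr (_ *: _).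
  by rewrite opprD addrACA subrr add0r.
rewrite nrmZ cmod_half.
(* This mirrors [a^2 - b^2 = a (a - b) + (a - b) b] for the scalar iteration, in an order that
   requires no commutation. *)
have -> : Z' (Z' v) - Z (Z v) = Z' (Z' v - Z v) + (Z' (Z v) - Z (Z v)).
  by rewrite (linear_mapB (sqrt_iter_linear n.+1 : linear Z')) addrA subrK.
have h1 := nrmD (Z' (Z' v - Z v)) (Z' (Z v) - Z (Z v)).
have h2 := nrm_sqrt_iter n.+1 (Z' v - Z v).
have h3 := ler_wpM2l (andP (scalar_iter_itv n.+1)).1 (IH v).
have h4 := IH (Z v).
have d0 : 0 <= scalar_iter n.+1 - scalar_iter n.
  by rewrite subr_ge0 scalar_iter_nondecreasing.
have h5 := ler_wpM2l d0 (nrm_sqrt_iter n v).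
have -> : scalar_iter n.+2 = (1 + scalar_iter n.+1 ^+ 2) / 2 by [].
have e : scalar_iter n.+1 = (1 + scalar_iter n ^+ 2) / 2 by [].
rewrite {2}e.
move: h1 h2 h3 h4 h5; rewrite -/Z -/Z'.
move: (scalar_iter n.+1) (scalar_iter n) (nrm v) => a b c.
lra.
Qed.

Lemma sqrt_iter_dist m n v : (m <= n)%N ->
  nrm (sqrt_iter n v - sqrt_iter m v)
  <= (scalar_iter n - scalar_iter m) * nrm v.
Proof.
elim: n => [|n IH]; first by rewrite leqn0 => /eqP->; rewrite !subrr nrm0 mul0r.
rewrite leq_eqVlt => /predU1P[->|/IH {}IH].
  by rewrite !subrr nrm0 mul0r.
have := sqrt_iter_step n v.
have := nrm_tri (sqrt_iter n.+1 v) (sqrt_iter n v) (sqrt_iter m v); lra.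
Qed.

(** The scalar iteration is monotone and bounded, hence Cauchy, and controls the operators. The rate
    is uniform on the unit ball, which lets limits pass through compositions such as [Z (Z v)]. *)
Lemma sqrt_iter_limit : exists Z : V -> V, forall e : R, 0 < e ->
  exists N, forall n, (N <= n)%N ->
  forall v, nrm (Z v - sqrt_iter n v) <= e * nrm v.
Proof.
have zs : has_sup (range scalar_iter).
  split; first by exists (scalar_iter 0), 0%N.
  by exists 1 => _ [n _ <-]; have /andP[] := scalar_iter_itv n.
have zle n : scalar_iter n <= sup (range scalar_iter).
  by apply: ub_le_sup; [case: zs|exists n].
have unif (e : R) : 0 < e -> exists N, forall m n v, (N <= m)%N -> (N <= n)%N ->
    nrm (sqrt_iter m v - sqrt_iter n v) <= e * nrm v.
  move=> e0; have [_ [N _ <-] hN] := sup_adherent e0 zs; exists N.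
  have key m n v : (N <= n)%N -> (n <= m)%N ->
      nrm (sqrt_iter m v - sqrt_iter n v) <= e * nrm v.
    move=> Nn nm; apply: le_trans (sqrt_iter_dist v nm) _.
    rewrite ler_wpM2r ?nrm_ge0 //.
    have := zle m; have := scalar_iter_nondecreasing Nn; lra.
  move=> m n v Nm Nn; case/orP: (leq_total m n) => mn; last exact: key.
  by rewrite nrmBC key.
have /choice[Z ZP] v : exists l, forall e : R, 0 < e ->
    exists N, forall n, (N <= n)%N -> nrm (l - sqrt_iter n v) < e.
  apply: cauchy_converges => e e0.
  have v1 : 0 < nrm v + 1 by rewrite ltr_wpDl ?nrm_ge0.
  have [N hN] := unif _ (divr_gt0 e0 v1); exists N => m n Nm Nn.
  apply: le_lt_trans (hN m n v Nm Nn) _.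
  by rewrite mulrAC ltr_pdivrMr // ltr_pM2l // ltrDl.
exists Z => e e0; have [N hN] := unif e e0; exists N => n Nn v.
apply/ler_addgt0Pr => d d0; have [M hM] := ZP v d d0.
have := hM _ (leq_maxl M N); have := hN _ n v (leq_maxr M N) Nn.
have := nrm_tri (Z v) (sqrt_iter (maxn M N) v) (sqrt_iter n v); lra.
Qed.

Section Limit.
Variables (Z : V -> V)
  (ZP : forall e : R, 0 < e -> exists N, forall n, (N <= n)%N ->
    forall v, nrm (Z v - sqrt_iter n v) <= e * nrm v).

Lemma limit_ext (W : normedModType R[i]) (u v : W) (C : R) : 0 <= C ->
  (forall e : R, 0 < e -> nrm (u - v) <= e * C) -> u = v.
Proof.
move=> C0 h; apply/eqP; rewrite -subr_eq0; apply/eqP/nrm_small0 => e e0.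
have C1 : 0 < C + 1 by lra.
apply: le_trans (h _ (divr_gt0 e0 C1)) _.
by rewrite mulrAC ler_pdivrMr // ler_wpM2l ?ltW // ltrDl.
Qed.

Lemma sqrt_limit_linear : linear Z.
Proof.
move=> c u v.
apply: (@limit_ext _ _ _ (nrm (c *: u + v) + cmod c * nrm u + nrm v)).
  by rewrite !addr_ge0 ?mulr_ge0 ?nrm_ge0 ?cmod_ge0.
move=> e /ZP[n /(_ _ (leqnn n)) hn].
have -> : Z (c *: u + v) - (c *: Z u + Z v) =
    (Z (c *: u + v) - sqrt_iter n (c *: u + v))
    - (c *: (Z u - sqrt_iter n u) + (Z v - sqrt_iter n v)).
  by rewrite sqrt_iter_linear scalerBr addrACA -opprD opprB addrA subrK.
have := nrmB (Z (c *: u + v) - sqrt_iter n (c *: u + v))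
  (c *: (Z u - sqrt_iter n u) + (Z v - sqrt_iter n v)).
have := nrmD (c *: (Z u - sqrt_iter n u)) (Z v - sqrt_iter n v).
rewrite nrmZ; have := hn (c *: u + v); have := hn v.
have := ler_wpM2l (cmod_ge0 c) (hn u); lra.
Qed.

Lemma sqrt_limit_contractive v : nrm (Z v) <= nrm v.
Proof.
apply/ler_addgt0Pr => d d0.
have v1 : 0 < nrm v + 1 by rewrite ltr_wpDl ?nrm_ge0.
have [n /(_ _ (leqnn n)) hn] := ZP (divr_gt0 d0 v1).
have h : d / (nrm v + 1) * nrm v <= d.
  by rewrite mulrAC ler_pdivrMr // ler_wpM2l ?ltW // ltrDl.
have := nrm_leB (Z v) (sqrt_iter n v); have := hn v; have := nrm_sqrt_iter n v.
have := ler_wpM2r (nrm_ge0 v) (andP (scalar_iter_itv n)).2; lra.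
Qed.

(** In other words [(1 - Z)^2 = 1 - X], so that [1 - Z] is the desired square root. *)
Lemma sqrt_limitE v : Z v + Z v - Z (Z v) = X v.
Proof.
apply: (@limit_ext _ _ _ (nrm v + nrm v + (nrm (Z v) + nrm v))).
  by rewrite !addr_ge0 ?nrm_ge0.
move=> e /ZP[n hn]; have {}hn1 := hn _ (leqnSn n); have {}hn := hn _ (leqnn n).
have -> : Z v + Z v - Z (Z v) - X v =
    (Z v - sqrt_iter n.+1 v) + (Z v - sqrt_iter n.+1 v)
    - ((Z (Z v) - sqrt_iter n (Z v)) + sqrt_iter n (Z v - sqrt_iter n v)).
  rewrite (linear_mapB (sqrt_iter_linear n)).
  have e2 : sqrt_iter n.+1 v + sqrt_iter n.+1 v
      = X v + sqrt_iter n (sqrt_iter n v).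
    have h2 : (2^-1)%:C + (2^-1)%:C = 1 :> R[i].
      by apply: eq_ReIm; rewrite !ReImE /=; lra.
    by rewrite /= -scalerDl h2 scale1r.
  have -> : Z (Z v) - sqrt_iter n (Z v)
      + (sqrt_iter n (Z v) - sqrt_iter n (sqrt_iter n v))
      = Z (Z v) - sqrt_iter n (sqrt_iter n v) by rewrite addrA subrK.
  rewrite [X in _ = X - _]addrACA -[X in _ = _ + X - _]opprD e2 opprB opprD.
  by rewrite !addrA subrK addrAC.
have := nrmB ((Z v - sqrt_iter n.+1 v) + (Z v - sqrt_iter n.+1 v))
  ((Z (Z v) - sqrt_iter n (Z v)) + sqrt_iter n (Z v - sqrt_iter n v)).
have := nrmD (Z v - sqrt_iter n.+1 v) (Z v - sqrt_iter n.+1 v).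
have := nrmD (Z (Z v) - sqrt_iter n (Z v)) (sqrt_iter n (Z v - sqrt_iter n v)).
have := nrm_sqrt_iter n (Z v - sqrt_iter n v).
have := ler_wpM2r (nrm_ge0 (Z v - sqrt_iter n v)) (andP (scalar_iter_itv n)).2.
have := hn v; have := hn1 v; have := hn (Z v); lra.
Qed.

Lemma sqrt_limit_commute (W : V -> V) (C : R) :
  linear W -> 0 <= C -> (forall v, nrm (W v) <= C * nrm v) ->
  (forall v, W (X v) = X (W v)) -> forall v, W (Z v) = Z (W v).
Proof.
move=> Wl C0 WC WX v.
have Wn n u : W (sqrt_iter n u) = sqrt_iter n (W u).
  elim: n u => [|n IH] u /=; first by rewrite (linear_map0 Wl).
  by rewrite (linear_mapZ Wl) (linear_mapD Wl) WX !IH.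
apply: (@limit_ext _ _ _ (C * nrm v + nrm (W v))).
  by rewrite addr_ge0 ?mulr_ge0 ?nrm_ge0.
move=> e /ZP[n /(_ _ (leqnn n)) hn].
have := nrm_tri (W (Z v)) (sqrt_iter n (W v)) (Z (W v)).
rewrite [X in _ <= _ + X]nrmBC -{1}Wn -(linear_mapB Wl).
have := WC (Z v - sqrt_iter n v); have := hn (W v).
have := ler_wpM2l C0 (hn v); lra.
Qed.

(** Meant for [s u v = cmul (cstar u) v], which is algebra-valued and conjugate linear in [u]; hence
    the hypotheses of additivity and of compatibility with the real scalar 1/2. *)
Lemma sqrt_limit_adjoint (W : normedModType R[i]) (s : V -> V -> W) :
  (forall u v w, s (u + v) w = s u w + s v w) ->
  (forall u v w, s w (u + v) = s w u + s w v) ->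
  (forall u v, nrm (s u v) <= nrm u * nrm v) ->
  (forall u v, s ((2^-1)%:C *: u) v = s u ((2^-1)%:C *: v)) ->
  (forall u v, s (X u) v = s u (X v)) ->
  forall u v, s (Z u) v = s u (Z v).
Proof.
move=> sDl sDr s1 sZ sX u v.
have s0l w : s 0 w = 0.
  have := sDl 0 0 w; rewrite addr0 => /eqP.
  by rewrite eq_sym -subr_eq0 addrK => /eqP.
have s0r w : s w 0 = 0.
  have := sDr 0 0 w; rewrite addr0 => /eqP.
  by rewrite eq_sym -subr_eq0 addrK => /eqP.
have sNl x w : s (- x) w = - s x w.
  by apply/eqP; rewrite -addr_eq0 -sDl addNr s0l.
have sNr x w : s w (- x) = - s w x.
  by apply/eqP; rewrite -addr_eq0 -sDr addNr s0r.
have sn n x y : s (sqrt_iter n x) y = s x (sqrt_iter n y).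
  elim: n x y => [|n IH] x y /=; first by rewrite s0l s0r.
  rewrite sZ sDl sX !IH -sDr !(linear_mapZ Xl).
  by rewrite !(linear_mapZ (sqrt_iter_linear n)) -scalerDr.
apply: (@limit_ext _ _ _ (2 * (nrm u * nrm v))).
  by rewrite !mulr_ge0 ?nrm_ge0.
move=> e /ZP[n /(_ _ (leqnn n)) hn].
have := nrm_tri (s (Z u) v) (s u (sqrt_iter n v)) (s u (Z v)).
rewrite [X in _ <= _ + X]nrmBC -{1}sn.
rewrite -(sNl (sqrt_iter n u)) -(sNr (sqrt_iter n v)) -sDl -sDr.
have := s1 (Z u - sqrt_iter n u) v; have := s1 u (Z v - sqrt_iter n v).
have := ler_wpM2r (nrm_ge0 v) (hn u).
have := ler_wpM2l (nrm_ge0 u) (hn v); lra.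
Qed.

End Limit.
End SquareRoot.

(** * Representations are contractive *)

Section CStarBasics.
Variables (R : realType) (D : cstarType R).
Implicit Types a b c : D.

Lemma nrm_cmul a b : nrm (cmul a b) <= nrm a * nrm b.
Proof. by rewrite -lecR rmorphM /= -!nrmE cnorm_mul. Qed.

Lemma nrm_cstar_cmul a : nrm (cmul (cstar a) a) = nrm a ^+ 2.
Proof. by apply: complexI; rewrite rmorphXn /= -!nrmE cnorm_star. Qed.

Lemma nrm_cstar a : nrm (cstar a) = nrm a.
Proof.
have le b : nrm b <= nrm (cstar b).
  have := nrm_cmul (cstar b) b; rewrite nrm_cstar_cmul expr2.
  have [->|b0] := eqVneq (nrm b) 0; first by rewrite nrm_ge0.
  by rewrite ler_pM2r // lt_neqAle eq_sym b0 nrm_ge0.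
by apply/eqP; rewrite eq_le le andbT -{2}[a]cstarK le.
Qed.

Lemma cstarN a : cstar (- a) = - cstar a.
Proof. by have := cstarZ (-1) a; rewrite rmorphN1 !scaleN1r. Qed.

Lemma cmul_linear a : linear (cmul a).
Proof. by move=> c u v; rewrite linearPr. Qed.

Lemma cmulBr a b c : cmul a (b - c) = cmul a b - cmul a c.
Proof. exact: linearBr. Qed.

Lemma cmulBl a b c : cmul (a - b) c = cmul a c - cmul b c.
Proof. exact: linearBl. Qed.

Section Reps.
Variable s : rep D.
Implicit Types h k : rep_space s.

Lemma rep_linear a : linear (rep_act s a).
Proof. by move=> c u v; rewrite linearPr. Qed.

Lemma rep_linear_l h : linear (rep_act s ^~ h).
Proof. by move=> c u v /=; rewrite linearPl. Qed.

Lemma rep_adjoint a h k : ip h (rep_act s a k) = ip (rep_act s (cstar a) h) k.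
Proof. by rewrite rep_star cstarK. Qed.

Lemma ip_rep_cstar a h : ip (rep_act s (cmul (cstar a) a) h) h
  = (nrm (rep_act s a h) ^+ 2)%:C.
Proof. by rewrite rep_mul rep_star cstarK ip_nrm. Qed.

(** The element [c = (1 - b^* b)^(1/2) a] makes sense in the algebra even without a unit, as
    [a - Z a]. From [c^* c = a^* a - (b a)^* (b a)], the squared norm of [c h] is the difference of
    those of [a h] and [b a h]. *)
Let rep_contractive_range b a h : nrm b <= 1 ->
  nrm (rep_act s b (rep_act s a h)) <= nrm (rep_act s a h).
Proof.
move=> b1; pose x := cmul (cstar b) b.
have x1 v : nrm (cmul x v) <= nrm v.
  apply: le_trans (nrm_cmul _ _) _; rewrite nrm_cstar_cmul.
  by rewrite ler_piMl ?nrm_ge0 // expr_le1 ?nrm_ge0.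
have [Z ZP] := sqrt_iter_limit (cmul_linear x) x1.
have Zl := sqrt_limit_linear (cmul_linear x) ZP.
pose c := a - Z a.
have ReImE' : c - Z c = a - cmul x a.
  rewrite -(sqrt_limitE (cmul_linear x) x1 ZP) /c (linear_mapB Zl) !opprB.
  by rewrite opprD addrACA [RHS]addrA.
have adj := sqrt_limit_adjoint (cmul_linear x) ZP
  (s := fun u v => cmul (cstar u) v).
have key : cmul (cstar c) c
    = cmul (cstar a) a - cmul (cstar (cmul b a)) (cmul b a).
  rewrite [in LHS]/c cstarD cstarN cmulBl adj.
  - by rewrite -cmulBr ReImE' cmulBr cstarM /x -!cmulA.
  - by move=> u v w; rewrite cstarD linearDl.
  - by move=> u v w; rewrite linearDr.
  - by move=> u v; rewrite -[nrm u]nrm_cstar nrm_cmul.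
  - move=> u v; rewrite cstarZ linearZl_LR linearZr_LR; congr (_ *: _).
    by apply: eq_ReIm; rewrite !ReImE //= oppr0.
  - by move=> u v; rewrite cstarM cstarM cstarK -!cmulA.
have : 0 <= nrm (rep_act s c h) ^+ 2 by rewrite sqr_ge0.
rewrite nrm_sqr -[X in ip _ (X)]/(rep_act s c h) rep_adjoint -rep_mul key.
rewrite linearBl ipBl !ip_rep_cstar rep_mul. rewrite !ReImE /= subr_ge0.
by rewrite ler_sqr ?nnegrE ?nrm_ge0.
Qed.

Lemma rep_contractive b h : nrm (rep_act s b h) <= nrm b * nrm h.
Proof.
(* The vector [h] need not be of the form [a k], but [x h] is, for [x = c^* c]. With norms [p], [q],
   [r] of [h], [x h], [c h], Cauchy-Schwarz gives [r^2 <= q p], and the bound on the range gives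
   [q^2 <= q p]. *)
have unit c : nrm c <= 1 -> nrm (rep_act s c h) <= nrm h.
  move=> c1; pose x := cmul (cstar c) c.
  have x1 : nrm x <= 1 by rewrite nrm_cstar_cmul expr_le1 ?nrm_ge0.
  have CS1 : nrm (rep_act s c h) ^+ 2 <= nrm (rep_act s x h) * nrm h.
    have := le_trans (Re_le_cmod _) (cauchy_schwarz (rep_act s x h) h).
    by rewrite ip_rep_cstar /= ger0_norm ?sqr_ge0.
  have CS2 : nrm (rep_act s x h) ^+ 2 <= nrm (rep_act s x h) * nrm h.
    apply: le_trans (ler_wpM2r (nrm_ge0 _) (rep_contractive_range x h x1)).
    have := le_trans (Re_le_cmod _)
      (cauchy_schwarz (rep_act s x (rep_act s x h)) h).
    have xs : cstar x = x by rewrite /x cstarM cstarK.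
    by rewrite rep_star xs ip_nrm /= ger0_norm ?sqr_ge0.
  have := nrm_ge0 (rep_act s c h); have := nrm_ge0 (rep_act s x h).
  have := nrm_ge0 h; move: CS1 CS2.
  move: (nrm _) (nrm _) (nrm _) => p q r h1 h2 r0 q0 p0.
  rewrite -ler_sqr ?nnegrE //; nra.
have [b0|b0] := eqVneq (nrm b) 0.
  by rewrite (nrm0_eq b0) linear0l !nrm0 mul0r.
have b_gt0 : 0 < nrm b by rewrite lt_neqAle eq_sym b0 nrm_ge0.
have := unit ((nrm b)^-1%:C *: b).
rewrite linearZl_LR !nrmZ cmodR ger0_norm ?invr_ge0 ?nrm_ge0 // mulVf //.
by rewrite ler_pdivrMl // => ->.
Qed.

Lemma rep_ip_continuous h k :
  continuous (fun a : D => ip (rep_act s a h) k : R[i]^o).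
Proof.
move=> a; apply/cvgrPdist_lt => e e0.
have eE := ge0_ReE (ltW e0).
have C0 : 0 < nrm h * nrm k + 1 by rewrite ltr_wpDl ?mulr_ge0 ?nrm_ge0.
have e'0 : 0 < (complex.Re e / (nrm h * nrm k + 1))%:C.
  by rewrite ltr0c divr_gt0 // -ltr0c -eE.
near=> b.
rewrite -ipBl -linearBl /= [X in X < _]cmodE eE ltcR.
apply: le_lt_trans (cauchy_schwarz _ _) _.
have ab : nrm (a - b) < complex.Re e / (nrm h * nrm k + 1).
  rewrite -ltcR -nrmE; near: b; exact: cvgr_dist_lt.
move: ab; rewrite ltr_pdivlMr // mulrDr mulr1.
have := ler_wpM2r (nrm_ge0 k) (rep_contractive (a - b) h).
have := nrm_ge0 (a - b); lra.
Unshelve. all: by end_near.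
Qed.

End Reps.
End CStarBasics.

(** * Schur's lemma *)

Lemma closed_subspace_ker (R : realType) (V W : normedModType R[i])
    (f : V -> W) (C : R) :
  linear f -> 0 <= C -> (forall v, nrm (f v) <= C * nrm v) ->
  closed_subspace [set v | f v = 0].
Proof.
move=> fl C0 fC; split=> [||c u v /= u0 v0]; last first.
- by rewrite fl u0 v0 scaler0 addr0.
- by rewrite /= linear_map0.
apply/closed_nrmP => v hv; apply: nrm_small0 => e e0.
have C1 : 0 < C + 1 by lra.
have [u u0 uv] := hv _ (divr_gt0 e0 C1).
rewrite -[f v]subr0 -(u0 : f u = 0) -linear_mapB //.
apply: le_trans (fC _) _; move: uv; rewrite ltr_pdivlMr // => uv.
have := nrm_ge0 (v - u); lra.
Qed.

Section Schur.
Variables (R : realType) (D : cstarType R) (s : rep D).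
Hypothesis s_irr : irreducible s.
Notation H := (rep_space s).

Lemma irreducible_ker (f : H -> H) (C : R) :
  linear f -> 0 <= C -> (forall h, nrm (f h) <= C * nrm h) ->
  (forall a h, f (rep_act s a h) = rep_act s a (f h)) ->
  (forall h, f h = 0 -> h = 0) \/ (forall h, f h = 0).
Proof.
move=> fl C0 fC fs.
have [|f0|fT] := s_irr.2 _ (closed_subspace_ker fl C0 fC).
- by move=> a h /= h0; rewrite fs h0 linear0r.
- by left=> h h0; have : [set v | f v = 0] h by []; rewrite f0.
- by right=> h; have : [set: H] h by []; rewrite -fT.
Qed.

(* With [A = |S|] the square root of [S^2], the range of [A + S] lies in the
   invariant subspace [ker (A - S)]; hence [A = S] or [A = - S]. *)
Lemma commutant_definite (S : H -> H) :
  linear S -> (forall h, nrm (S h) <= nrm h) ->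
  (forall h k, ip (S h) k = ip h (S k)) ->
  (forall a h, S (rep_act s a h) = rep_act s a (S h)) ->
  (forall h, 0 <= complex.Re (ip (S h) h)) \/
  (forall h, complex.Re (ip (S h) h) <= 0).
Proof.
move=> Sl S1 Ssa Ss; pose X h := h - S (S h).
have Xl : linear X.
  by move=> c u v; rewrite /X !Sl opprD addrACA scalerBr.
have ipX h : ip (X h) h = (nrm h ^+ 2 - nrm (S h) ^+ 2)%:C.
  by rewrite /X ipBl Ssa !ip_nrm; apply: eq_ReIm; rewrite !ReImE /= ?subr0.
have Xpos : positive_form (fun h k => ip (X h) k).
  split=> [c u v w|c u v w|u]; [by rewrite Xl ipPl|by rewrite ipPr|].
  by rewrite ipX ler0c subr_ge0 ler_sqr ?nnegrE ?nrm_ge0.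
(* Cauchy-Schwarz for the form of [X] converts the bound on [(X h | h)] into a norm bound. *)
have X1 h : nrm (X h) <= nrm h.
  apply: nrm_le_ip => [|k]; first exact: nrm_ge0.
  rewrite -ler_sqr ?nnegrE ?cmod_ge0 ?mulr_ge0 ?nrm_ge0 //.
  apply: le_trans (pform_cauchy_schwarz Xpos h k) _.
  rewrite !ipX /= exprMn ler_pM ?subr_ge0 ?ler_sqr ?nnegrE ?nrm_ge0 //;
    by rewrite lerBlDr lerDl sqr_ge0.
have [Z ZP] := sqrt_iter_limit Xl X1.
have Zl := sqrt_limit_linear Xl ZP.
pose A h := h - Z h.
have Al : linear A.
  by move=> c u v; rewrite /A Zl opprD addrACA scalerBr.
have AE h : A (A h) = S (S h).
  rewrite {1}/A /A (linear_mapB Zl) opprB.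
  have -> : S (S h) = h - X h by rewrite /X opprB addrC subrK.
  by rewrite -(sqrt_limitE Xl X1 ZP) opprB opprD addrACA [RHS]addrA.
have AS h : S (A h) = A (S h).
  rewrite /A (linear_mapB Sl); congr (_ - _).
  apply: (sqrt_limit_commute ZP Sl ler01) => v; rewrite ?mul1r //.
  by rewrite /X (linear_mapB Sl).
have Arep a h : rep_act s a (A h) = A (rep_act s a h).
  rewrite /A (linear_mapB (rep_linear _)); congr (_ - _).
  apply: (sqrt_limit_commute ZP (rep_linear _) (nrm_ge0 a)) => v.
    exact: rep_contractive.
  by rewrite /X (linear_mapB (rep_linear _)) !Ss.
have A_ge0 h : 0 <= complex.Re (ip (A h) h).
  rewrite /A ipBl ip_nrm !ReImE /= subr_ge0.
  apply: le_trans (le_trans (ler_norm _) (Re_le_cmod _)) _.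
  apply: le_trans (cauchy_schwarz _ _) _.
  by rewrite expr2 ler_wpM2r ?nrm_ge0 // (sqrt_limit_contractive X1 ZP).
have A_le h : nrm (A h) <= 2 * nrm h.
  rewrite /A; have := nrmB h (Z h); have := sqrt_limit_contractive X1 ZP h; lra.
move: A Al AE AS Arep A_ge0 A_le => A Al AE AS Arep A_ge0 A_le.
have [||||inj|zero] := @irreducible_ker (fun h => A h - S h) 3.
- by move=> c u v /=; rewrite Al Sl opprD addrACA scalerBr.
- by [].
- move=> h; have := nrmB (A h) (S h); have := S1 h; have := A_le h; lra.
- by move=> a h; rewrite -Arep Ss linearBr.
- right=> h; have : A h + S h = 0.
    apply: inj; rewrite (linear_mapD Al) (linear_mapD Sl) AE AS.
    by rewrite [X in _ - X]addrC subrr.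
  move=> /eqP; rewrite addrC addr_eq0 => /eqP ->.
  by have := A_ge0 h; rewrite linearNl !ReImE oppr_le0.
- left=> h; have /eqP := zero h; rewrite subr_eq0 => /eqP <-.
  exact: A_ge0.
Qed.

(** The form of [T - t] vanishes at [xi] and is semidefinite, so Cauchy-Schwarz puts [xi] in the
    kernel of [T - t]; this kernel is invariant and nonzero, hence everything. *)
Lemma schur (T : H -> H) (C : R) (xi : H) :
  linear T -> 0 <= C -> (forall h, nrm (T h) <= C * nrm h) ->
  (forall h k, ip (T h) k = ip h (T k)) ->
  (forall a h, T (rep_act s a h) = rep_act s a (T h)) ->
  nrm xi = 1 ->
  forall h, T h = ip (T xi) xi *: h.
Proof.
move=> Tl C0 TC Tsa Ts xi1.
have TR h : ip (T h) h = (complex.Re (ip (T h) h))%:C.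
  apply: eq_ReIm => //=; have := ipC (T h) h; rewrite -Tsa.
  by case: (ip _ _) => p q [] /=; lra.
set t := ip (T xi) xi; have tR : t = (complex.Re t)%:C by exact: TR.
(* The factor [l] scales [T - t] to a contraction. *)
pose l := (C + cmod t + 1)^-1.
have l0 : 0 < l by rewrite invr_gt0; have := cmod_ge0 t; lra.
pose S h := l%:C *: (T h - t *: h).
have Sl : linear S.
  move=> c u v; rewrite /S Tl (scalerDr t) opprD addrACA scalerDr.
  by rewrite scalerA (mulrC t) -scalerA -scalerBr scalerA mulrC -scalerA.
have S1 h : nrm (S h) <= nrm h.
  rewrite nrmZ cmodR (ger0_norm (ltW l0)) /l ler_pdivrMl; last first.
    by have := cmod_ge0 t; lra.
  have := nrmB (T h) (t *: h); rewrite nrmZ; have := TC h; have := nrm_ge0 h.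
  lra.
have Ssa h k : ip (S h) k = ip h (S k).
  rewrite /S ipZl ipZr ipBl ipBr ipZl ipZr Tsa.
  by rewrite tR; apply: eq_ReIm; rewrite !ReImE /=; ring.
have Ss a h : S (rep_act s a h) = rep_act s a (S h).
  rewrite /S Ts (linear_mapZ (rep_linear _)) (linear_mapB (rep_linear _)).
  by rewrite (linear_mapZ (rep_linear _)).
have Sxi0 : ip (S xi) xi = 0.
  by rewrite /S ipZl ipBl ipZl ip_nrm xi1 expr1n mulr1 subrr mulr0.
have SR h : ip (S h) h = (complex.Re (ip (S h) h))%:C.
  apply: eq_ReIm => //=; have := ipC (S h) h; rewrite -Ssa.
  by case: (ip _ _) => p q [] /=; lra.
have zero_sq k : cmod (ip (S xi) k) ^+ 2 <= 0 -> ip (S xi) k = 0.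
  move=> h; apply: cmod0_eq; apply/eqP; rewrite -sqrf_eq0.
  by rewrite eq_le h sqr_ge0.
have Sxi : S xi = 0.
  apply: ip_ext => k; rewrite ip0l; apply: zero_sq.
  have [pos|neg] := commutant_definite Sl S1 Ssa Ss.
    have P : positive_form (fun h k => ip (S h) k).
      split=> [c u v w|c u v w|u]; [by rewrite Sl ipPl|by rewrite ipPr|].
      by rewrite SR ler0c.
    by have := pform_cauchy_schwarz P xi k; rewrite Sxi0 mul0r.
  have P : positive_form (fun h k => - ip (S h) k).
    split=> [c u v w|c u v w|u]; [rewrite Sl ipPl|rewrite ipPr|].
    - by rewrite opprD mulrN.
    - by rewrite opprD mulrN.
    - by rewrite SR -rmorphN ler0c oppr_ge0.
  by have := pform_cauchy_schwarz P xi k; rewrite Sxi0 oppr0 mul0r cmodN.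
have S0 : forall h, S h = 0.
  have [|inj|//] := irreducible_ker Sl ler01 _ Ss.
    by move=> h; rewrite mul1r.
  by move: xi1; rewrite (inj _ Sxi) nrm0 => /esym/eqP; rewrite oner_eq0.
move=> h; have /eqP := S0 h; rewrite scaler_eq0 subr_eq0 => /orP[|/eqP//].
by rewrite eq_complex /= gt_eqF.
Qed.

End Schur.

(** * Purity of the vector states of irreducible representations *)

Section Dense.
Variables (R : realType) (V : normedModType R[i]).

Definition dense_family (I : Type) (p : I -> V) : Prop :=
  forall (v : V) (e : R), 0 < e -> exists i, nrm (v - p i) < e.

Lemma closure_subspace (S : set V) : S 0 ->
  (forall (c : R[i]) u v, S u -> S v -> S (c *: u + v)) ->
  closed_subspace (closure S).
Proof.
move=> S0 Sl; split; first exact: closed_closure.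
  exact: subset_closure.
move=> c u v /closure_nrmP Su /closure_nrmP Sv; apply/closure_nrmP => e e0.
have c1 : 0 < cmod c + 1 by have := cmod_ge0 c; lra.
have e2 : 0 < e / 2 by lra.
have [u' Su' uu'] := Su _ (divr_gt0 e2 c1).
have [v' Sv' vv'] := Sv _ e2.
exists (c *: u' + v'); first exact: Sl.
have -> : c *: u + v - (c *: u' + v') = c *: (u - u') + (v - v').
  by rewrite opprD addrACA scalerBr.
have := nrmD (c *: (u - u')) (v - v'); rewrite nrmZ.
move: uu'; rewrite ltr_pdivlMr // mulrDr mulr1.
have := nrm_ge0 (u - u'); lra.
Qed.

End Dense.

Lemma dense_ip_ext (R : realType) (H : hilbertType R) (I : Type) (p : I -> H)
    (h k : H) :
  dense_family p -> (forall i, ip h (p i) = ip k (p i)) -> h = k.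
Proof.
move=> dp hk; apply/eqP; rewrite -subr_eq0; apply/eqP.
apply: nrm_small0 => e e0.
have [i hi] := dp (h - k) e e0.
set d := h - k in hi *.
have d0 : ip d (p i) = 0 by rewrite ipBl hk ?subrr.
have : nrm d ^+ 2 <= nrm d * e.
  rewrite nrm_sqr; have -> : ip d d = ip d (d - p i) by rewrite ipBr d0 subr0.
  apply: le_trans (le_trans (ler_norm _) (Re_le_cmod _)) _.
  apply: le_trans (cauchy_schwarz _ _) _.
  by rewrite ler_wpM2l ?nrm_ge0 // ltW.
have := nrm_ge0 d; nra.
Qed.

Lemma dense_nrm_le (R : realType) (H : hilbertType R) (I : Type) (p : I -> H)
    (h : H) (C : R) :
  dense_family p -> 0 <= C -> (forall i, cmod (ip h (p i)) <= C * nrm (p i)) ->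
  nrm h <= C.
Proof.
move=> dp C0 hC; have h0 := nrm_ge0 h.
have : nrm h ^+ 2 <= C * nrm h.
  apply/ler_addgt0Pr => d d0.
  have Ch : 0 < C + nrm h + 1 by lra.
  have [i hi] := dp h _ (divr_gt0 d0 Ch).
  move: hi; rewrite ltr_pdivlMr // => hi.
  have -> : nrm h ^+ 2 = complex.Re (ip h (p i)) + complex.Re (ip h (h - p i)).
    by rewrite nrm_sqr -ReD -ipDr addrC subrK.
  have := le_trans (ler_norm _) (le_trans (Re_le_cmod _) (hC i)).
  have := le_trans (ler_norm _)
    (le_trans (Re_le_cmod _) (cauchy_schwarz h (h - p i))).
  have := nrm_leB (p i) h; rewrite nrmBC => /(ler_wpM2l C0).
  have := nrm_ge0 (h - p i); lra.
nra.
Qed.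

Section Irreducible.
Variables (R : realType) (D : cstarType R) (s : rep D).
Hypothesis s_irr : irreducible s.
Notation H := (rep_space s).

Lemma irreducible_dense (S : set H) : S 0 ->
  (forall (c : R[i]) u v, S u -> S v -> S (c *: u + v)) ->
  (forall a u, S u -> S (rep_act s a u)) ->
  (exists2 u, S u & u <> 0) ->
  forall h (e : R), 0 < e -> exists2 u, S u & nrm (h - u) < e.
Proof.
move=> S0 Sl Ss [u Su u0] h e e0.
have [|cS|cS] := s_irr.2 _ (closure_subspace S0 Sl).
- move=> a v /closure_nrmP Sv; apply/closure_nrmP => d d0.
  have a1 : 0 < nrm a + 1 by have := nrm_ge0 a; lra.
  have [w Sw vw] := Sv _ (divr_gt0 d0 a1).
  exists (rep_act s a w); first exact: Ss.
  rewrite -linearBr; apply: le_lt_trans (rep_contractive _ _) _.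
  move: vw; rewrite ltr_pdivlMr //; have := nrm_ge0 (v - w); lra.
- by have /u0 : [set 0] u by rewrite -cS; exact: subset_closure.
- have /closure_nrmP hS : closure S h by rewrite cS.
  exact: hS.
Qed.

Lemma irreducible_nondegenerate h : (forall a, rep_act s a h = 0) -> h = 0.
Proof.
move=> h0.
have K : closed_subspace [set k | forall a, rep_act s a k = 0].
  have Ka a := closed_subspace_ker (@rep_linear _ _ s a) (nrm_ge0 a)
    (@rep_contractive _ _ s a).
  split=> [|a|c u v /= u0 v0 a]; last 2 first.
  - exact: linear0r.
  - by rewrite linearPr u0 v0 scaler0 addr0.
  apply/closed_nrmP => v hv a; have [/closed_nrmP Kc _ _] := Ka a.
  by apply: Kc => e /hv[u /(_ a)]; exists u.
have [|K0|KT] := s_irr.2 _ K.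
- by move=> a k /= k0 b; rewrite k0 linear0r.
- by have : [set k | forall a, rep_act s a k = 0] h by []; rewrite K0.
- have [[a [k /eqP ak]] _] := s_irr; case: ak.
  have : [set: H] k by [].
  by rewrite -KT; apply.
Qed.

Lemma irreducible_cyclic xi : xi <> 0 ->
  dense_family (fun a => rep_act s a xi).
Proof.
move=> xi0 h e e0.
have [||||_ [a _ <-]] :=
  @irreducible_dense (range (rep_act s ^~ xi)) _ _ _ _ h e e0.
- by exists 0 => //; exact: linear0l.
- move=> c _ _ [a _ <-] [b _ <-]; exists (c *: a + b) => //.
  exact: linearPl.
- by move=> a _ [b _ <-]; exists (cmul a b) => //; exact: rep_mul.
- have [//|nz] := pselect (exists a, rep_act s a xi <> 0).
    by move=> [a a0]; exists (rep_act s a xi) => //; exists a.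
  case: xi0; apply: irreducible_nondegenerate => a.
  by apply: contrapT => a0; apply: nz; exists a.
- by exists a.
Qed.

End Irreducible.

(** Here [u] and [v] stand for [|phi x|] and the norm of [x xi], where [x] almost fixes [xi], and
    [k] for the ratio of a functional to [phi]. In the limit the inequality reads [k^2 <= k]. *)
Lemma contraction_ratio_le1 (R : realType) (k : R) :
  (forall e : R, 0 < e -> e < 1 -> exists u v,
     [/\ 1 - e <= u, 0 <= v, v <= 1 + e & k ^+ 2 * u ^+ 2 <= k * v ^+ 2]) ->
  k <= 1.
Proof.
move=> h; rewrite leNgt; apply/negP => k1.
have k2 : 0 < 2 * (k + 1) by lra.
(* This [e] solves [k (1 - 2 e) = 1 + 2 e], so [k (1 - e)^2] exceeds [(1 + e)^2] by
   [(k - 1) e^2]. *)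
have e0 : 0 < (k - 1) / (2 * (k + 1)) by rewrite divr_gt0 //; lra.
have e1 : (k - 1) / (2 * (k + 1)) < 1 by rewrite ltr_pdivrMr //; lra.
have [u [v [u1 v0 v1]]] := h _ e0 e1.
have eE : (k - 1) / (2 * (k + 1)) * (2 * (k + 1)) = k - 1.
  by rewrite divfK ?gt_eqF.
move: e0 e1 u1 v1 eE; move: ((k - 1) / _) => e e0 e1 u1 v1 eE.
rewrite expr2 -!mulrA ler_pM2l; last by lra.
have : v ^+ 2 <= (1 + e) ^+ 2 by rewrite ler_sqr ?nnegrE; lra.
have : k * (1 - e) ^+ 2 <= k * u ^+ 2.
  by rewrite ler_pM2l ?ler_sqr ?nnegrE; lra.
have k0 : 0 < k - 1 by lra.
have := mulr_gt0 (mulr_gt0 e0 e0) k0.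
lra.
Qed.

(* Kadison's inequalities [f_pos] and [f_le] say that [f] and [2 phi - f] are
   positive functionals of norm at most 1. *)
Section Purity.
Variables (R : realType) (D : cstarType R) (s : rep D) (xi : rep_space s).
Hypotheses (s_irr : irreducible s) (xi1 : nrm xi = 1).
Notation H := (rep_space s).
Local Notation p a := (rep_act s a xi).
Local Notation phi a := (ip (rep_act s a xi) xi).

Lemma unit_neq0 : xi <> 0.
Proof.
by move=> x0; move: xi1; rewrite x0 nrm0 => /esym/eqP; rewrite oner_eq0.
Qed.

Lemma vector_state_star a b : phi (cmul (cstar b) a) = ip (p a) (p b).
Proof. by rewrite rep_mul rep_star cstarK. Qed.

(** The approximant is a product because [f] will first be identified on products. *)
Lemma approx_identity (e : R) : 0 < e ->
  exists c d, nrm (xi - rep_act s (cmul c d) xi) < e.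
Proof.
move=> e0; have cyc := irreducible_cyclic s_irr unit_neq0.
have [|c hc] := cyc xi (e / 2); first by lra.
have c1 : 0 < nrm c + 1 by have := nrm_ge0 c; lra.
have [|d hd] := cyc xi (e / 2 / (nrm c + 1)); first by rewrite !divr_gt0.
exists c, d; have := nrm_tri xi (rep_act s c xi) (rep_act s (cmul c d) xi).
rewrite rep_mul -linearBr; have := rep_contractive c (xi - rep_act s d xi).
move: hd; rewrite ltr_pdivlMr //; have := nrm_ge0 (xi - rep_act s d xi); lra.
Qed.

Variable f : D -> R[i].
Hypotheses (fl : forall c a b, f (c *: a + b) = c * f a + f b)
  (f_pos : forall a, (cmod (f a) ^+ 2)%:C <= f (cmul (cstar a) a))
  (f_le : forall a, (cmod (2 * phi a - f a) ^+ 2)%:C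
    <= 2 * phi (cmul (cstar a) a) - f (cmul (cstar a) a)).

Local Notation F a b := (f (cmul (cstar b) a)).

Lemma dominated_positive_form : positive_form (fun a b => F a b).
Proof.
split=> [c u v w|c u v w|u].
- by rewrite linearPr fl.
- by rewrite cstarD cstarZ linearPl fl.
- by apply: le_trans (f_pos u); rewrite ler0c sqr_ge0.
Qed.

Lemma dominated_form_le a b : cmod (F a b) <= 2 * nrm (p a) * nrm (p b).
Proof.
have d c : complex.Re (F c c) <= 2 * nrm (p c) ^+ 2.
  have := f_le c; rewrite vector_state_star ip_nrm.
  rewrite lecE => /andP[_]; rewrite !ReImE /=.
  have := sqr_ge0 (cmod (2 * phi c - f c)); lra.
have F0 c : 0 <= complex.Re (F c c).
  by have := pform_ge0 dominated_positive_form c; rewrite lecE => /andP[].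
rewrite -ler_sqr ?nnegrE ?cmod_ge0 ?mulr_ge0 ?nrm_ge0 //.
apply: le_trans (pform_cauchy_schwarz dominated_positive_form a b) _.
apply: le_trans (ler_pM (F0 a) (F0 b) (d a) (d b)) _.
by rewrite le_eqVlt; apply/orP; left; apply/eqP; ring.
Qed.

(** [T] is the Radon-Nikodym derivative of [f] with respect to [phi]. A first use of [riesz]
    represents [F a c] by a vector [K c]. The assignment [p c |-> K c] lives on a dense subspace;
    rather than extending it by continuity, a second use of [riesz] defines [T] as its adjoint, and
    [Tp] shows that [T] extends it. *)
Lemma dominated_form_operator : exists T : H -> H,
  [/\ linear T, (forall h, nrm (T h) <= 2 * nrm h),
    (forall h k, ip (T h) k = ip h (T k)),
    (forall a h, T (rep_act s a h) = rep_act s a (T h)) &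
    forall a b, F a b = ip (p a) (T (p b))].
Proof.
have cyc : dense_family (rep_act s ^~ xi) := irreducible_cyclic s_irr unit_neq0.
have pl : linear (rep_act s ^~ xi) := @rep_linear_l _ _ s xi.
have Fh := pform_hermitian dominated_positive_form.
have /choice[K KE] c : exists k, forall a, F a c = ip (p a) k.
  apply: (@riesz _ _ _ (rep_act s ^~ xi) _ (2 * nrm (p c))) => // [r a b|a].
    by rewrite (pformPl dominated_positive_form).
  by rewrite mulrAC dominated_form_le.
have KE' c a : ip (K c) (p a) = F c a by rewrite ipC -KE -Fh.
have Kl r a b : K (r *: a + b) = r *: K a + K b.
  apply: (dense_ip_ext cyc) => /= d.
  by rewrite ipPl !KE' (pformPl dominated_positive_form).
have K2 c : nrm (K c) <= 2 * nrm (p c).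
  apply: (dense_nrm_le cyc); first by rewrite mulr_ge0 ?nrm_ge0.
  by move=> a /=; rewrite KE' dominated_form_le.
have /choice[T TE] h : exists k, forall c, ip (K c) h = ip (p c) k.
  apply: (@riesz _ _ _ (rep_act s ^~ xi) _ (2 * nrm h)) => // [r a b|c].
    by rewrite Kl ipPl.
  apply: le_trans (cauchy_schwarz _ _) _; rewrite mulrAC.
  by rewrite ler_wpM2r ?nrm_ge0.
have TE' h c : ip (T h) (p c) = ip h (K c) by rewrite ipC -TE -ipC.
have Tp c : T (p c) = K c.
  by apply: (dense_ip_ext cyc) => /= a; rewrite TE' KE' -KE.
have Tl : linear T.
  by move=> r h k; apply: (dense_ip_ext cyc) => /= a; rewrite TE' !ipPl !TE'.
have T2 h : nrm (T h) <= 2 * nrm h.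
  apply: (dense_nrm_le cyc) => [|c] /=; first by rewrite mulr_ge0 ?nrm_ge0.
  rewrite TE'; apply: le_trans (cauchy_schwarz _ _) _.
  by have := ler_wpM2l (nrm_ge0 h) (K2 c); lra.
exists T; split=> //.
- move=> h k; apply/eqP; rewrite -subr_eq0; apply/eqP/cmod0_eq.
  apply/eqP; rewrite eq_le cmod_ge0 andbT; apply/ler_addgt0Pr => e e0.
  have h1 : 0 < 4 * nrm h + 1 by have := nrm_ge0 h; lra.
  have [c] := cyc k _ (divr_gt0 e0 h1); rewrite ltr_pdivlMr // => hc.
  have -> : ip (T h) k - ip h (T k)
      = ip (T h) (k - p c) - ip h (T (k - p c)).
    rewrite (linear_mapB Tl) !ipBr Tp TE'; ring.
  have := cmodD (ip (T h) (k - p c)) (- ip h (T (k - p c))).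
  rewrite cmodN; have := cauchy_schwarz (T h) (k - p c).
  have := cauchy_schwarz h (T (k - p c)).
  have := ler_wpM2l (nrm_ge0 h) (T2 (k - p c)).
  have := ler_wpM2r (nrm_ge0 (k - p c)) (T2 h).
  have := nrm_ge0 (k - p c); lra.
- move=> a h; apply: (dense_ip_ext cyc) => /= c.
  rewrite TE' !rep_star -rep_mul -[RHS]/(ip (T h) (p (cmul (cstar a) c))) TE'.
  congr (ip h _); apply: (dense_ip_ext cyc) => /= d.
  rewrite KE' rep_star cstarK -rep_mul.
  by rewrite -[LHS]/(ip (K c) (p (cmul a d))) KE' cstarM cmulA.
- by move=> a b; rewrite Tp KE.
Qed.

(** By Schur's lemma [T] is a scalar [k], so [f = k phi] on products. Kadison's inequality for [f]
    yields [k <= 1], and that for [2 phi - f] yields [2 - k <= 1]. *)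
Lemma vector_state_pure b : f b = phi b.
Proof.
have [T [Tl T2 Tsa Ts FE]] := dominated_form_operator.
have TE := schur s_irr Tl (ler0n _ 2) T2 Tsa Ts xi1.
set t := ip (T xi) xi in TE.
have tR : t = (complex.Re t)%:C.
  apply: eq_ReIm => //=; have := ipC (T xi) xi; rewrite -Tsa -/t.
  by case: t {TE} => x y [] /=; lra.
move: (complex.Re t) tR => k tR.
have fE a c : f (cmul a c) = k%:C * phi (cmul a c).
  rewrite -[a]cstarK FE TE ipZr tR vector_state_star; congr (_ * _).
  by apply: eq_ReIm; rewrite !ReImE //= oppr0.
have app (e : R) : 0 < e -> exists c d, let x := cmul c d in
    [/\ 1 - e <= cmod (phi x), nrm (p x) <= 1 + e & 0 < nrm (p x)] .
  move=> e0; have e1 : 0 < Num.min e 2^-1 by rewrite lt_min e0 /= invr_gt0.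
  have [c [d]] := approx_identity e1; rewrite lt_min => /andP[he h2].
  exists c, d => /=; set x := cmul c d in he h2 *.
  have h3 := nrm_leB xi (p x); have h4 := nrm_leB (p x) xi.
  rewrite nrmBC xi1 in h4; rewrite xi1 in h3.
  split; first last.
  - by move: h3 h2; lra.
  - by move: h4 he; lra.
  have : cmod (ip xi xi) <= cmod (phi x) + cmod (ip (xi - p x) xi).
    by rewrite ipBl -{1}[ip xi xi](subrK (phi x)) addrC cmodD.
  rewrite ip_nrm xi1 expr1n cmodR normr1.
  have := cauchy_schwarz (xi - p x) xi; rewrite xi1 mulr1; lra.
have k1 : k <= 1.
  apply: contraction_ratio_le1 => e e0 e1; have [c [d [h1 h2 h3]]] := app e e0.
  exists (cmod (phi (cmul c d))), (nrm (p (cmul c d))); split=> //.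
    exact: nrm_ge0.
  have := f_pos (cmul c d); rewrite !fE vector_state_star ip_nrm -rmorphM lecR.
  by rewrite cmodM cmodR exprMn real_normK ?num_real.
have k1' : 2 - k <= 1.
  apply: contraction_ratio_le1 => e e0 e1; have [c [d [h1 h2 h3]]] := app e e0.
  exists (cmod (phi (cmul c d))), (nrm (p (cmul c d))); split=> //.
    exact: nrm_ge0.
  have := f_le (cmul c d); rewrite !fE -!mulrBl.
  have -> : 2 - k%:C = (2 - k)%:C by rewrite rmorphB rmorph_nat.
  rewrite vector_state_star ip_nrm -rmorphM lecR.
  by rewrite cmodM cmodR exprMn real_normK ?num_real.
have {k1 k1'}k1 : k = 1 by lra.
have {}fE a c : f (cmul a c) = phi (cmul a c) by rewrite fE k1 mul1r.
(* From products to arbitrary [b]: if [c] almost fixes [xi], both functionals are small at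
   [b - b c], for [f] by Kadison's inequality, whose right-hand side is a value at a product. *)
apply/eqP; rewrite -subr_eq0; apply/eqP/cmod0_eq.
apply/eqP; rewrite eq_le cmod_ge0 andbT; apply/ler_addgt0Pr => e e0.
have b1 : 0 < 2 * nrm b + 1 by have := nrm_ge0 b; lra.
have [c] := irreducible_cyclic s_irr unit_neq0 xi (divr_gt0 e0 b1).
rewrite ltr_pdivlMr // => hc.
have fB x y : f (x - y) = f x - f y.
  by rewrite [x - y]addrC -scaleN1r fl mulN1r [RHS]addrC.
have pB : p (b - cmul b c) = rep_act s b (xi - p c).
  by rewrite linearBl linearBr rep_mul.
have h1 : cmod (f (b - cmul b c)) <= nrm b * nrm (xi - p c).
  apply: le_trans (rep_contractive b (xi - p c)).
  rewrite -ler_sqr ?nnegrE ?cmod_ge0 ?nrm_ge0 // -lecR.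
  by apply: le_trans (f_pos _) _; rewrite fE vector_state_star ip_nrm -pB.
have h2 : cmod (phi (b - cmul b c)) <= nrm b * nrm (xi - p c).
  apply: le_trans (cauchy_schwarz _ _) _; rewrite xi1 mulr1 pB.
  exact: rep_contractive.
have -> : f b - phi b = f (b - cmul b c) - phi (b - cmul b c).
  by rewrite fB fE linearBl ipBl; ring.
have := cmodD (f (b - cmul b c)) (- phi (b - cmul b c)); rewrite cmodN.
have := nrm_ge0 (xi - p c); lra.
Qed.

End Purity.

(** * Orthogonal vectors in states close to a pure state *)

Lemma ultrafilter_bounded_limit (R : realType) (T : Type) (U : set_system T)
    (u : T -> R) (M : R) :
  UltraFilter U -> U [set t | `|u t| <= M] ->
  exists l, forall d : R, 0 < d -> U [set t | `|u t - l| < d].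
Proof.
move=> UU UM.
have ub : (u @ U) `[- M, M]%classic.
  change (U [set t | u t \in `[- M, M]]).
  by apply: filterS UM => t /=; rewrite in_itv /= ler_norml.
have [l [_ ul]] := @segment_compact R _ _ (u @ U) _ ub.
exists l => d d0; have [|far] := in_ultra_setVsetC (u @^-1` ball l d) UU.
  by apply: filterS => t; rewrite /= /ball /= distrC.
by have [y []] := ul (~` ball l d) (ball l d) far (nbhsx_ballx l d d0).
Qed.

(** The factor 2 is the squared norm of the vector [u x + y] to which this is applied, a sum of two
    orthogonal unit vectors. *)
Lemma kadison_limit (R : realType) (x z : R[i]) :
  (forall d : R, 0 < d -> exists p q, [/\ cmod (p - x) <= d, cmod (q - z) <= d &
    (cmod p ^+ 2)%:C <= 2 * q]) ->
  (cmod x ^+ 2)%:C <= 2 * z.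
Proof.
move=> h.
have two (q : R[i]) : 2 * q = q + q by rewrite mulr_natl mulr2n.
have Imz : complex.Im z = 0.
  apply/eqP; rewrite -normr_eq0 eq_le normr_ge0 andbT.
  apply/ler_addgt0Pr => d d0; have [p [q [_ qz]]] := h d d0.
  rewrite two lecE => /andP[/eqP]; rewrite !ReImE /= => Iq _.
  have := le_trans (Im_le_cmod _) qz; rewrite !ReImE.
  have -> : complex.Im q = 0 by lra.
  by rewrite sub0r normrN add0r.
rewrite two lecE !ReImE /= Imz addr0 eqxx /=.
apply/ler_addgt0Pr => e e0.
pose X := cmod x; have X0 : 0 <= X := cmod_ge0 x.
have X1 : 0 < 2 * X + 5 by lra.
(* An approximation within [d] costs at most [d (2 X + 2 + 3 d)], hence at most [d (2 X + 5)] when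
   [d <= 1]. *)
have d0 : 0 < Num.min 1 (e / (2 * X + 5)) by rewrite lt_min ltr01 divr_gt0.
have [p [q []]] := h _ d0.
have : Num.min 1 (e / (2 * X + 5)) <= 1 by rewrite ge_min lexx.
have : Num.min 1 (e / (2 * X + 5)) <= e / (2 * X + 5).
  by rewrite ge_min lexx orbT.
rewrite ler_pdivlMr //; move: (Num.min _ _) d0 => d d0 de d1 px qz.
rewrite two lecE !ReImE /= => /andP[_ hp].
have := le_trans (ler_norm _) (le_trans (Re_le_cmod _) qz); rewrite !ReImE.
have xp : X <= cmod p + d.
  have := cmodD (x - p) p; rewrite subrK -/X.
  by have := cmodN (x - p); rewrite opprB; lra.
have pX : cmod p <= X + d.
  by have := cmodD (p - x) x; rewrite subrK -/X; lra.
have p0 := cmod_ge0 p; rewrite -/X => Rq.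
have : X ^+ 2 <= (cmod p + d) ^+ 2 by rewrite ler_sqr ?nnegrE //; lra.
nra.
Qed.

Section OffDiagonal.
Variables (R : realType) (D : cstarType R).

(** A set of functionals and not of triples [(t, x, y)]: the functionals form one fixed type on
    which a filter can be placed, while the space of [t] varies. *)
Definition near_orthogonal_pair (phi : D -> R[i]) (b : D) (e : R)
    (F : seq D) (d : R) : set (D -> R[i]) :=
  [set th | exists (t : rep D) (x y : rep_space t),
    [/\ nrm x = 1, nrm y = 1, ip x y = 0, e <= cmod (th b) &
      (forall a, th a = ip (rep_act t a x) y) /\
      forall a, a \in F -> cmod (ip (rep_act t a x) x - phi a) < d /\
        cmod (ip (rep_act t a y) y - phi a) < d]].

(** The sets shrink as [F] grows and [d] decreases, so they generate a proper filter; on a finer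
    ultrafilter [th a] converges, being bounded by the norm of [a]. The conclusion quantifies over
    finite [F] so that the ultrafilter stays inside this proof. *)
Lemma pair_limit (phi : D -> R[i]) (b : D) (e : R) :
  (forall F d, 0 < d -> near_orthogonal_pair phi b e F d !=set0) ->
  exists Th : D -> R[i], forall F d, 0 < d ->
    exists2 th, near_orthogonal_pair phi b e F d th &
      forall a, a \in F -> cmod (th a - Th a) < d.
Proof.
move=> ne.
pose B := filter_from [set q : seq D * R | 0 < q.2]
  (fun q => near_orthogonal_pair phi b e q.1 q.2).
have BF : ProperFilter B.
  apply: filter_from_proper => [|[F d] /= d0]; last exact: ne.
  apply: filter_from_filter; first by exists ([::], 1) => /=.
  move=> [F d] [F' d'] /= d0 d'0; exists (F ++ F', Num.min d d') => /=.
    by rewrite lt_min d0.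
  move=> th [t [x [y [x1 y1 xy eb [thE h]]]]].
  split; exists t, x, y; split=> //; split=> // a aF;
    by have := h a; rewrite mem_cat aF ?orbT !lt_min
      => /(_ isT)[/andP[? ?] /andP[? ?]].
have [U [UU BU]] := ultraFilterLemma BF.
have bound a : U [set th : D -> R[i] | cmod (th a) <= nrm a].
  apply: BU; exists ([::], 1) => //= th [t [x [y [x1 y1 _ _ [thE _]]]]] /=.
  rewrite thE; apply: le_trans (cauchy_schwarz _ _) _.
  by rewrite y1 mulr1 -[leRHS]mulr1 -x1 rep_contractive.
have /choice[Th ThP] a : exists l : R[i], forall d, 0 < d ->
    U [set th : D -> R[i] | cmod (th a - l) < d].
  have bRe : U [set th : D -> R[i] | `|complex.Re (th a)| <= nrm a].
    apply: (filterS _ (bound a)) => th /=.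
    by apply: le_trans; exact: Re_le_cmod.
  have bIm : U [set th : D -> R[i] | `|complex.Im (th a)| <= nrm a].
    apply: (filterS _ (bound a)) => th /=.
    by apply: le_trans; exact: Im_le_cmod.
  have [p hp] := ultrafilter_bounded_limit UU bRe.
  have [q hq] := ultrafilter_bounded_limit UU bIm.
  exists (p +i* q) => d d0; have d2 : 0 < d / 2 by lra.
  apply: (filterS _ (filterI (hp _ d2) (hq _ d2))) => th [/= h1 h2].
  rewrite -ltr_sqr ?nnegrE ?cmod_ge0 ?(ltW d0) // cmod_sqr !ReImE /=.
  move: h1 h2; rewrite !ltr_norml => /andP[h1 h1'] /andP[h2 h2'].
  move: h1 h1' h2 h2'; move: (_ - p) (_ - q) => v w ? ? ? ?; nra.
exists Th => F d d0.
have UF : U [set th : D -> R[i] | forall a, a \in F -> cmod (th a - Th a) < d].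
  elim: F => [|a F IH]; first by apply: filterS filterT => th _ a.
  apply: (filterS _ (filterI (ThP a _ d0) IH)) => th [/= h1 h2] c.
  by rewrite inE => /predU1P[->//|/h2].
have UG : U (near_orthogonal_pair phi b e F d).
  by apply: BU; exists (F, d).
by have [th [? ?]] := filter_ex (filterI UG UF); exists th.
Qed.

Variables (s : rep D) (xi : rep_space s).
Hypotheses (s_irr : irreducible s) (xi1 : nrm xi = 1).
Local Notation phi := (fun a => ip (rep_act s a xi) xi).

(** For [|u| = 1] the functionals of the vectors [u x + y] tend to [2 f u], where [f u] is [phi]
    plus a term in [Th]. Each [f u] satisfies Kadison's inequality, and [phi] is the midpoint of
    [f u] and [f (- u)], so purity forces [f u = phi]. *)
Lemma pair_limit_eq0 (b : D) (e : R) (Th : D -> R[i]) :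
  (forall F d, 0 < d ->
    exists2 th, near_orthogonal_pair phi b e F d th &
      forall a, a \in F -> cmod (th a - Th a) < d) ->
  forall a, Th a = 0.
Proof.
move=> ThP.
have Thl c x y : Th (c *: x + y) = c * Th x + Th y.
  apply/eqP; rewrite -subr_eq0; apply/eqP/cmod0_eq.
  apply/eqP; rewrite eq_le cmod_ge0 andbT; apply/ler_addgt0Pr => d d0.
  have c2 : 0 < cmod c + 2 by have := cmod_ge0 c; lra.
  have [th [t [u [v [_ _ _ _ [thE _]]]]]] :=
    ThP [:: c *: x + y; x; y] _ (divr_gt0 d0 c2).
  move=> h; have := h (c *: x + y); have := h x; have := h y.
  rewrite !inE !eqxx ?orbT => /(_ isT) hy /(_ isT) hx /(_ isT).
  have -> : th (c *: x + y) = c * th x + th y by rewrite !thE linearPl ipPl.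
  move=> hxy; rewrite add0r.
  have -> : Th (c *: x + y) - (c * Th x + Th y) = c * (th x - Th x)
      + (th y - Th y) - (c * th x + th y - Th (c *: x + y)) by ring.
  have := cmodD (c * (th x - Th x) + (th y - Th y))
    (- (c * th x + th y - Th (c *: x + y))).
  have := cmodD (c * (th x - Th x)) (th y - Th y).
  rewrite cmodN cmodM.
  have := ler_wpM2l (cmod_ge0 c) (ltW hx).
  have : d / (cmod c + 2) * (cmod c + 2) = d by rewrite divfK ?gt_eqF.
  lra.
pose f (u : R[i]) a :=
  phi a + (2^-1)%:C * (u * Th a + Num.conj (u * Th (cstar a))).
have half : (2^-1)%:C + (2^-1)%:C = 1 :> R[i].
  by apply: eq_ReIm; rewrite !ReImE /=; lra.
have two (q : R[i]) : 2 * q = q + q by rewrite mulr_natl mulr2n.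
have fl u c x y : f u (c *: x + y) = c * f u x + f u y.
  rewrite /f cstarD cstarZ !Thl linearPl ipPl !(rmorphM, rmorphD) /= conjCK.
  ring.
have f_pos u : cmod u = 1 -> forall a,
    (cmod (f u a) ^+ 2)%:C <= f u (cmul (cstar a) a).
  move=> u1 a.
  suff : (cmod (f u a + f u a) ^+ 2)%:C
      <= 2 * (f u (cmul (cstar a) a) + f u (cmul (cstar a) a)).
    move: (f u a) (f u (cmul (cstar a) a)) => z w.
    have -> : z + z = 2%:C * z by rewrite rmorph_nat two.
    rewrite cmodM cmodR normr_nat !two !lecE !ReImE /= => /andP[/eqP h1 h2].
    by apply/andP; split; [apply/eqP; lra|lra].
  apply: kadison_limit => d d0.
  pose aa := cmul (cstar a) a.
  (* Four errors: the states of [x] and of [y], and [th] at an element and at its adjoint. The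
     adjoints are in the finite set because [(t(c) y | x)] is the conjugate of [th (cstar c)]. *)
  have d4 : 0 < d / 4 by lra.
  have [th [t [x [y [x1 y1 xy _ [thE h]]]]]] :=
    ThP [:: a; cstar a; aa; cstar aa] _ d4.
  move=> hTh; pose v := u *: x + y.
  have uu : u * Num.conj u = 1 by rewrite mulJE u1 expr1n.
  have vE c : ip (rep_act t c v) v = ip (rep_act t c x) x + ip (rep_act t c y) y
      + (u * th c + Num.conj (u * th (cstar c))).
    rewrite /v (rep_linear c u x y) ipPl !ipPr !thE rmorphM /=.
    rewrite (ipC (rep_act t c y) x) rep_adjoint.
    have e1 : ip (rep_act t c x) x = u * Num.conj u * ip (rep_act t c x) x.
      by rewrite uu mul1r.
    rewrite [in RHS]e1; ring.
  have close c : c \in [:: a; cstar a; aa; cstar aa] ->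
      cstar c \in [:: a; cstar a; aa; cstar aa] ->
      cmod (ip (rep_act t c v) v - (f u c + f u c)) <= d.
    move=> cF c'F; have [hx hy] := h c cF.
    have hT := hTh c cF; have hT' := hTh _ c'F.
    have -> : ip (rep_act t c v) v - (f u c + f u c) =
      (ip (rep_act t c x) x - phi c) + (ip (rep_act t c y) y - phi c)
      + (u * (th c - Th c) + Num.conj (u * (th (cstar c) - Th (cstar c)))).
      have -> : f u c + f u c
          = phi c + phi c + (u * Th c + Num.conj (u * Th (cstar c))).
        by rewrite /f addrACA -mulrDl half mul1r.
      rewrite vE !mulrBr rmorphB /=; ring.
    have := cmodD (ip (rep_act t c x) x - phi c) (ip (rep_act t c y) y - phi c).
    have := cmodD
      ((ip (rep_act t c x) x - phi c) + (ip (rep_act t c y) y - phi c))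
      (u * (th c - Th c) + Num.conj (u * (th (cstar c) - Th (cstar c)))).
    have := cmodD (u * (th c - Th c))
      (Num.conj (u * (th (cstar c) - Th (cstar c)))).
    rewrite cmodJ !cmodM u1 !mul1r; lra.
  have v2 : nrm v ^+ 2 = 2.
    rewrite nrm_sqrD ipZl xy mulr0 nrmZ u1 x1 y1 /=; lra.
  exists (ip (rep_act t a v) v), (ip (rep_act t aa v) v); split.
  - by apply: close; rewrite !inE eqxx ?orbT.
  - by apply: close; rewrite !inE eqxx ?orbT.
  - rewrite ip_rep_cstar.
    have -> : 2 * (nrm (rep_act t a v) ^+ 2)%:C
        = (nrm (rep_act t a v) ^+ 2 * 2)%:C.
      by rewrite two mulr_natr mulr2n rmorphD.
    rewrite lecR -v2 -exprMn ler_sqr ?nnegrE ?cmod_ge0 ?mulr_ge0 ?nrm_ge0 //.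
    exact: cauchy_schwarz.
have fE u : cmod u = 1 -> forall a, f u a = phi a.
  move=> u1; apply: vector_state_pure => // [|a]; first exact: f_pos.
  have fN c : 2 * phi c - f u c = f (- u) c.
    rewrite /f two !mulNr !rmorphN /=; ring.
  by rewrite !fN; apply: f_pos; rewrite cmodN.
move=> a.
have i1 : cmod ('i : R[i]) = 1.
  by rewrite /cmod normc_def /= expr0n expr1n add0r sqrtr1.
have one1 : cmod (1 : R[i]) = 1 by rewrite /cmod normr1.
have eq0 u : cmod u = 1 -> u * Th a + Num.conj (u * Th (cstar a)) = 0.
  move=> u1.
  have /eqP : (2^-1)%:C * (u * Th a + Num.conj (u * Th (cstar a))) = 0.
    by apply: (@addrI _ (phi a)); rewrite addr0; exact: fE.
  rewrite mulf_eq0 => /orP[|/eqP//].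
  by rewrite eq_complex /= invr_eq0 pnatr_eq0.
(* [u = 1] and [u = 'i] give [Th a = - conj (Th (cstar a))] and [Th a = conj (Th (cstar a))]. *)
have h1 := eq0 1 one1; have h2 := eq0 'i i1.
rewrite !mul1r in h1.
move/(congr1 (@complex.Re R)): (h1); move/(congr1 (@complex.Im R)): (h1).
move/(congr1 (@complex.Re R)): (h2); move/(congr1 (@complex.Im R)): (h2).
rewrite !ReImE /= => *; apply: eq_ReIm => /=; lra.
Qed.

Lemma off_diagonal_small (b : D) (e : R) : 0 < e ->
  exists (F : seq D) (d : R), 0 < d /\
    forall (t : rep D) (x y : rep_space t),
    nrm x = 1 -> nrm y = 1 -> ip x y = 0 ->
    (forall a, a \in F -> cmod (ip (rep_act t a x) x - phi a) < d) ->
    (forall a, a \in F -> cmod (ip (rep_act t a y) y - phi a) < d) ->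
    cmod (ip (rep_act t b x) y) < e.
Proof.
move=> e0; apply: contrapT => no.
have [|Th ThP] := @pair_limit phi b e.
  move=> F d d0; apply: contrapT => em; apply: no; exists F, d; split=> //.
  move=> t x y x1 y1 xy hx hy; rewrite ltNge; apply/negP => eb; apply: em.
  exists (fun a => ip (rep_act t a x) y); exists t, x, y.
  by split=> //; split=> // a aF; split; [exact: hx|exact: hy].
have Th0 := pair_limit_eq0 ThP.
have [th [t [x [y [_ _ _ eb _]]]]] := ThP [:: b] _ e0.
by move=> /(_ b); rewrite inE eqxx Th0 subr0 => /(_ isT); rewrite ltNge eb.
Qed.

End OffDiagonal.

(** * Weak* neighbourhoods and almost orthonormal families *)

Section WeakStar.
Variables (R : realType) (D : cstarType R).

Definition weakstar_basic (F : seq D) (d : R) : set (dual D) :=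
  [set nu | forall a, a \in F -> cmod (nu a) < d].

Lemma dual0_subproof : (fun _ : D => 0 : R[i]^o) \in @dual_set R D.
Proof.
rewrite inE; split; last exact: cst_continuous.
by move=> c u v; rewrite scaler0 addr0.
Qed.

Lemma weakstar_nbhs0_basic (F : seq D) (d : R) : 0 < d ->
  weakstar_nbhs0 (weakstar_basic F d).
Proof.
move=> d0; split; last first.
  exists (exist (fun f => f \in @dual_set R D) _ dual0_subproof) => //= a _.
  by rewrite /dual_app /= cmod0.
exists [set f : {ptws D -> R[i]^o} | forall a, a \in F -> `|f a| < d%:C];
    last first.
  apply/seteqP; split=> nu /= h a /h;
    by rewrite -[cmod _ < d]ltcR -cmodE.
elim: F => [|a F IH].
  rewrite [X in open X](_ : _ = setT); first exact: openT.
  by apply/seteqP; split.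
rewrite [X in open X](_ : _ =
    (fun f : {ptws D -> R[i]^o} => f a) @^-1` ball (0 : R[i]^o) d%:C `&`
    [set f : {ptws D -> R[i]^o} | forall b, b \in F -> `|f b| < d%:C]).
  apply: openI IH; apply: open_comp => [x _|].
    exact: (@proj_continuous D (fun=> R[i]^o) a).
  by apply: ball_open; rewrite ltr0c.
apply/seteqP; split=> f /=.
  move=> h; split=> [|b bF]; last by apply: h; rewrite inE bF orbT.
  by rewrite -ball_normE /= sub0r normrN; apply: h; rewrite inE eqxx.
move=> [fa fF] b; rewrite inE => /predU1P[->|]; last exact: fF.
by move: fa; rewrite -ball_normE /= sub0r normrN.
Qed.

Lemma weakstar_basic_sub (N : set (dual D)) : weakstar_nbhs0 N ->
  exists F d, 0 < d /\ weakstar_basic F d `<=` N.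
Proof.
move=> [[W oW WN] [z Nz z0]].
(* This filter converges pointwise to the zero functional, so every open set containing that
   functional includes one of its basic sets. *)
pose B := filter_from [set q : seq D * R | 0 < q.2]
  (fun q => [set f : D -> R[i]^o | forall a, a \in q.1 -> cmod (f a) < q.2]).
have BF : Filter B.
  apply: filter_from_filter; first by exists ([::], 1) => /=.
  move=> [F d] [F' d'] /= d0 d'0; exists (F ++ F', Num.min d d') => /=.
    by rewrite lt_min d0.
  move=> f fF; split=> a aF; have := fF a;
    by rewrite mem_cat aF ?orbT lt_min => /(_ isT)/andP[].
have cv : {ptws, B --> (val z : D -> R[i]^o)}.
  apply/pointwise_cvgP => a; apply/cvgrPdist_lt => e e0.
  have eE := ge0_ReE (ltW e0).
  exists ([:: a], complex.Re e) => /=; first by rewrite -ltr0c -eE.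
  move=> f /= /(_ a); rewrite inE eqxx => /(_ isT) fa.
  have -> : val z a = 0 by exact: z0.
  by rewrite sub0r normrN [X in X < _]cmodE eE ltcR.
have Wz : W (val z) by move: Nz; rewrite -WN.
have [q /= d0 FW] : B W by apply: cv; exact: open_nbhs_nbhs.
exists q.1, q.2; split=> // nu nuF; rewrite -WN /=; apply: FW => a aF.
exact: nuF.
Qed.

Lemma vector_functional_subproof (t : rep D) (x : rep_space t)
    (phi : dual D) :
  (fun a => ip (rep_act t a x) x - phi a : R[i]^o) \in @dual_set R D.
Proof.
have [phil phic] : @dual_set R D (val phi) by exact: set_valP.
rewrite inE; split.
  move=> c a b; rewrite linearPl ipPl [phi _]phil scalerDr scalerN.
  by rewrite opprD addrACA.
move=> a; apply: cvgB; [exact: rep_ip_continuous|exact: phic].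
Qed.

Definition vector_functional (t : rep D) (x : rep_space t) (phi : dual D) :
    dual D :=
  exist (fun f => f \in @dual_set R D) _ (vector_functional_subproof x phi).

Lemma VecP (t : rep D) (phi : dual D) (N : set (dual D))
    (x : rep_space t) :
  Vec phi N x <-> nrm x = 1 /\
   N (vector_functional x phi).
Proof.
have e : `|x| = 1 <-> nrm x = 1.
  by split=> h; [rewrite /nrm h|rewrite nrmE h].
split=> [[/e x1 [nu Nnu nuE]]|[/e x1 Nx]]; split=> //.
  rewrite (_ : vector_functional x phi = nu) //; apply: val_inj => /=.
  apply/funext => a; rewrite nuE addrC addKr //.
by eexists; [exact: Nx|] => a; rewrite /dual_app /= addrC subrK.
Qed.

Lemma vector_state_nrm (t : rep D) (phi : dual D) :
  vector_state t phi -> exists xi : rep_space t, nrm xi = 1 /\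
    forall a, phi a = ip (rep_act t a xi) xi.
Proof. by move=> [xi xi1 h]; exists xi; rewrite /nrm xi1. Qed.

End WeakStar.

(** Gram-Schmidt, with a tolerance [d] independent of the Hilbert space. Indexing by [nat] lets the
    induction reuse the same family for a smaller [n]. *)
Lemma near_orthonormal (R : realType) (n : nat) (e : R) : 0 < e ->
  exists2 d, 0 < d & forall (H : hilbertType R) (v : nat -> H),
    (forall i j, (i < n)%N -> (j < n)%N ->
      cmod (ip (v i) (v j) - (i == j)%:R) <= d) ->
    exists w : nat -> H,
      (forall i j, (i < n)%N -> (j < n)%N -> ip (w i) (w j) = (i == j)%:R) /\
      forall i, (i < n)%N -> nrm (w i - v i) <= e.
Proof.
elim: n e => [|n IH] e e0.
  by exists 1 => // H v _; exists v.
(* Each coefficient of the projection [p] of the last vector is at most [3 c], so [p] has norm at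
   most [3/8 e']. Normalizing [x - p] then costs at most [c + 3/8 e' <= e' / 2], for a total below
   [e]. *)
pose e' := Num.min e 1; pose c := e' / (8 * n.+1%:R).
have e'0 : 0 < e' by rewrite lt_min e0 ltr01.
have n0 : 0 < n.+1%:R :> R by rewrite ltr0n.
have c0 : 0 < c by rewrite divr_gt0 // mulr_gt0.
have [d0 d0_gt0 hd0] := IH c c0.
exists (Num.min d0 c); first by rewrite lt_min d0_gt0.
move=> H v hv.
have [|w [ww wv]] := hd0 H v.
  move=> i j i_n j_n; apply: le_trans (hv i j (ltnW i_n) (ltnW j_n)) _.
  by rewrite ge_min lexx.
have {}hv i j : (i <= n)%N -> (j <= n)%N ->
    cmod (ip (v i) (v j) - (i == j)%:R) <= c.
  move=> i_n j_n; apply: le_trans (hv i j i_n j_n) _.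
  by rewrite ge_min lexx orbT.
pose x := v n.
have nc : 8 * n.+1%:R * c = e' by rewrite /c mulrC divfK // gt_eqF // mulr_gt0.
have e'1 : e' <= 1 by rewrite ge_min lexx orbT.
have e'e : e' <= e by rewrite ge_min lexx.
have n1 : 1 <= n.+1%:R :> R by rewrite ler1n.
have c8 : 8 * c <= e' by rewrite -nc mulrAC ler_peMr // mulr_ge0 // ltW.
have xx : `|nrm x ^+ 2 - 1| <= c.
  have := hv n n (leqnn n) (leqnn n); rewrite eqxx ip_nrm -/x.
  by rewrite -(rmorph1 (real_complex R)) -rmorphB cmodR.
have x0 := nrm_ge0 x.
have x1 : `|nrm x - 1| <= c.
  move: xx; rewrite !ler_norml => /andP[h1 h2]; apply/andP; split; nra.
pose p := \sum_(i < n) ip x (w i) *: w i.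
have xw i : (i < n)%N -> cmod (ip x (w i)) <= 3 * c.
  move=> i_n; have -> : ip x (w i) = ip x (v i) + ip x (w i - v i).
    by rewrite -ipDr addrC subrK.
  have := cmodD (ip x (v i)) (ip x (w i - v i)).
  have := hv n i (leqnn n) (ltnW i_n); rewrite (gtn_eqF i_n) subr0 -/x.
  have := cauchy_schwarz x (w i - v i); have := wv i i_n.
  move: x1; rewrite ler_norml => /andP[_ x1].
  have := nrm_ge0 (w i - v i); nra.
have p_le : nrm p <= 3 / 8 * e'.
  apply: (@le_trans _ _ (\sum_(i < n) (3 * c))).
    rewrite /p; elim/big_rec2: _ => [|i y z _ h]; first by rewrite nrm0.
    apply: le_trans (nrmD _ _) _; apply: lerD => //.
    have w1 : nrm (w i) = 1.
      apply/eqP; rewrite -sqrp_eq1 ?nrm_ge0 // nrm_sqr ww // eqxx.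
      by rewrite -(rmorph1 (real_complex R)).
    by rewrite nrmZ w1 mulr1 xw.
  rewrite sumr_const card_ord -mulr_natl -nc -natr1.
  have := ler0n R n; nra.
pose u := x - p.
have uw j : (j < n)%N -> ip u (w j) = 0.
  move=> j_n; rewrite /u ipBl /p.
  have -> : ip (\sum_(i < n) ip x (w i) *: w i) (w j)
      = \sum_(i < n) ip x (w i) * (i == j :> nat)%:R.
    rewrite linear_sumlz; apply: eq_bigr => i _ /=.
    by rewrite ipZl ww.
  rewrite (bigD1 (Ordinal j_n)) //= eqxx mulr1 big1 ?addr0 ?subrr // => i ij.
  by rewrite (_ : (i == j :> nat) = false) ?mulr0 //; apply: negbTE.
have u1 : `|nrm u - 1| <= e' / 2.
  have := nrmB x p; have := nrm_leB x u.
  have -> : x - u = p by rewrite /u opprB addrC subrK.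
  rewrite -/u.
  move: x1; rewrite !ler_norml => /andP[? ?] ? ?; apply/andP; split; lra.
have u_gt0 : 0 < nrm u by move: u1; rewrite ler_norml => /andP[? ?]; lra.
pose y := (nrm u)^-1%:C *: u.
have yx : nrm (y - x) <= e.
  have := nrm_tri y u x.
  have -> : y - u = ((nrm u)^-1 - 1)%:C *: u.
    by rewrite rmorphB scalerBl scale1r.
  rewrite nrmZ cmodR -[X in _ * X](ger0_norm (nrm_ge0 u)) -normrM mulrBl.
  rewrite mulVf ?gt_eqF // mul1r distrC.
  have -> : u - x = - p by rewrite /u addrAC subrr add0r.
  rewrite nrmN; lra.
have yw j : (j < n)%N -> ip y (w j) = 0.
  by move=> j_n; rewrite ipZl uw // mulr0.
have yy : ip y y = 1.
  rewrite ip_nrm nrmZ cmodR ger0_norm ?invr_ge0 ?nrm_ge0 // mulVf ?gt_eqF //.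
  by rewrite expr1n.
exists (fun k => if k == n then y else w k); split=> [i j|i].
  rewrite !ltnS => i_n j_n.
  have [iE|i_neq] := eqVneq i n; have [jE|j_neq] := eqVneq j n.
  - by rewrite iE jE eqxx.
  - have jn : (j < n)%N by rewrite ltn_neqAle j_neq.
    by rewrite iE yw // gtn_eqF.
  - have jn : (i < n)%N by rewrite ltn_neqAle i_neq.
    by rewrite jE ipC yw // rmorph0 (negbTE i_neq).
  - by rewrite ww // ltn_neqAle ?i_neq ?j_neq.
rewrite ltnS => i_n; have [->//|i_neq] := eqVneq i n.
have i_lt : (i < n)%N by rewrite ltn_neqAle i_neq.
by apply: le_trans (wv i i_lt) _; lra.
Qed.

(** * Transfer of orthonormal families *)

Section Transfer.
Variable R : realType.

Definition orthonormal_Vec (D : cstarType R) (t : rep D) (phi : dual D)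
    (N : set (dual D)) (n : nat) : Prop :=
  exists2 e : 'I_n -> rep_space t,
    orthonormal_family e & forall i, Vec phi N (e i).

Lemma vector_state_close (D : cstarType R) (t : rep D) (u v : rep_space t)
    (e : R) (a : D) :
  nrm u = 1 -> nrm (u - v) <= e -> e <= 1 ->
  cmod (ip (rep_act t a u) u - ip (rep_act t a v) v) <= 3 * nrm a * e.
Proof.
move=> u1 uv e1.
have -> : ip (rep_act t a u) u - ip (rep_act t a v) v =
    ip (rep_act t a (u - v)) u + ip (rep_act t a v) (u - v).
  by rewrite linearBr ipBl ipBr; ring.
have v2 : nrm v <= 2 by have := nrm_leB v u; rewrite nrmBC; lra.
apply: le_trans (cmodD _ _) _.
have := cauchy_schwarz (rep_act t a (u - v)) u; rewrite u1 mulr1.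
have := cauchy_schwarz (rep_act t a v) (u - v).
have h1 := rep_contractive a (u - v).
have := ler_wpM2r (nrm_ge0 (u - v)) (rep_contractive a v).
have h2 := ler_wpM2l (nrm_ge0 a) uv.
have h3 := ler_pM (nrm_ge0 v) (nrm_ge0 (u - v)) v2 uv.
have := ler_wpM2l (nrm_ge0 a) h3; lra.
Qed.

Lemma nrm_sqr_close (H : hilbertType R) (u v : H) (e : R) :
  nrm u = 1 -> nrm (u - v) <= e -> e <= 1 -> `|nrm v ^+ 2 - 1| <= 3 * e.
Proof.
move=> u1 uv e1; have := nrm_leB v u; have := nrm_leB u v; rewrite (nrmBC v) u1.
have := nrm_ge0 v; have := nrm_ge0 (u - v).
move=> h0 h1 h2 h3; rewrite ler_norml; apply/andP; split; nra.
Qed.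

Variables (D E : cstarType R) (X : Type) (r : X -> X -> D) (act : E -> X -> X).

(* Common abstraction of the induction of representations and of its inverse:
   [L x] is the operator [h |-> x (x) h], resp. its adjoint. *)
Definition linked (t : rep D) (t' : rep E)
    (L : X -> rep_space t -> rep_space t') : Prop :=
  (forall x h y k, ip (L x h) (L y k) = ip (rep_act t (r x y) h) k) /\
  (forall a x h, rep_act t' a (L x h) = L (act a x) h).

Lemma linked_vector_state (t : rep D) (t' : rep E)
    (L : X -> rep_space t -> rep_space t') a x h : linked L ->
  ip (rep_act t' a (L x h)) (L x h) = ip (rep_act t (r (act a x) x) h) h.
Proof. by move=> [L1 L2]; rewrite L2 L1. Qed.

Variables (s : rep D) (s' : rep E) (L0 : X -> rep_space s -> rep_space s').
Arguments linked {t t'} L.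
Hypotheses (s_irr : irreducible s) (L0_linked : linked L0).
Variables (xi : rep_space s) (zeta : rep_space s').
Hypotheses (xi1 : nrm xi = 1) (zeta1 : nrm zeta = 1)
  (L0_dense : dense_family (fun x => L0 x xi)).
Variables (phi : dual D) (psi : dual E).
Hypotheses (phiE : forall a, phi a = ip (rep_act s a xi) xi)
  (psiE : forall a, psi a = ip (rep_act s' a zeta) zeta).

(** One [x] with [L0 x xi] near [zeta] is fixed before [t]. For linked [L], the Gram matrix and the
    states of the vectors [L x (e i)] are values of the functionals of the [e i] at elements of [D]
    that depend on [x] alone, hence the uniformity in [t]. *)
Lemma transfer_orthonormal_Vec (n : nat) (N' : set (dual E)) :
  weakstar_nbhs0 N' -> exists2 N, weakstar_nbhs0 N &
    forall (t : rep D) (t' : rep E) (L : X -> rep_space t -> rep_space t'),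
      linked L ->
      orthonormal_Vec t phi N n -> orthonormal_Vec t' psi N' n.
Proof.
move=> /weakstar_basic_sub[F' [d' [d'0 FN']]].
pose M := 1 + \sum_(a <- F') nrm a.
have M_ge a : a \in F' -> nrm a <= M.
  move=> aF; rewrite /M (big_rem a) //=.
  have : 0 <= \sum_(b <- rem a F') nrm b.
    by apply: sumr_ge0 => b _; exact: nrm_ge0.
  lra.
have M1 : 1 <= M by rewrite /M lerDl sumr_ge0 // => *; exact: nrm_ge0.
(* A vector displaced by [e0] changes its state at [a] by at most [3 M e0 <= d' / 4]. Three such
   errors occur below, together less than [d']. *)
pose e0 := Num.min 1 (d' / (12 * M)).
have M12 : 0 < 12 * M by lra.
have e0_gt0 : 0 < e0 by rewrite lt_min ltr01 divr_gt0.
have e01 : e0 <= 1 by rewrite ge_min lexx.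
have e0M : e0 * (12 * M) <= d' by rewrite -ler_pdivlMr // ge_min lexx orbT.
have [dg dg0 gram] := near_orthonormal n e0_gt0.
(* A diagonal Gram entry errs by at most [3 e2] from the norm of [L0 x xi] plus [d1] from the state
   of [e i], within [dg] in total. *)
pose e2 := Num.min e0 (dg / 4).
have e2_gt0 : 0 < e2 by rewrite lt_min e0_gt0 divr_gt0.
have e20 : e2 <= e0 by rewrite ge_min lexx.
have e2g : e2 <= dg / 4 by rewrite ge_min lexx orbT.
have [x /ltW hx] := L0_dense zeta e2_gt0.
have [F2 [d2 [d2_gt0 off]]] := off_diagonal_small s_irr xi1 (r x x) dg0.
pose d1 := Num.min (d' / 4) (Num.min (dg / 4) d2).
have d1_gt0 : 0 < d1 by rewrite !lt_min !divr_gt0.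
have d1d' : d1 <= d' / 4 by rewrite ge_min lexx.
have d1g : d1 <= dg / 4 by rewrite !ge_min lexx orbT.
have d12 : d1 <= d2 by rewrite !ge_min lexx !orbT.
(* The three parts control the diagonal Gram entries, the states of the [L x (e i)] on [F'], and the
   off-diagonal Gram entries. *)
pose F := r x x :: [seq r (act a x) x | a <- F'] ++ F2.
exists (weakstar_basic F d1); first exact: weakstar_nbhs0_basic.
move=> t t' L Ll [e e_on eV].
have eF i a : a \in F -> cmod (ip (rep_act t a (e i)) (e i)
    - ip (rep_act s a xi) xi) < d1.
  move=> aF; have [_ [nu nuF nuE]] := eV i.
  by rewrite nuE -phiE addrC addrA addNr add0r; exact: nuF.
have e1 i : nrm (e i) = 1 by have [/(congr1 (@complex.Re R))] := eV i.
(* Extension by 0 to all of [nat]; only indices below [n] are ever compared. *)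
pose v k := if insub k is Some i then L x (e i) else 0.
have vE (i : 'I_n) : v i = L x (e i) by rewrite /v valK.
have rF : r x x \in F by rewrite inE eqxx.
have [|w [ww wv]] := gram _ v.
  move=> i j i_n j_n; rewrite (vE (Ordinal i_n)) (vE (Ordinal j_n)) Ll.1.
  have [ij|ij] := eqVneq i j; last first.
    rewrite subr0; apply/ltW/off.
    - exact: e1.
    - exact: e1.
    - by rewrite e_on -val_eqE /= (negbTE ij).
    - move=> a aF; apply: lt_le_trans d12; apply: eF.
      by rewrite inE mem_cat aF !orbT.
    - move=> a aF; apply: lt_le_trans d12; apply: eF.
      by rewrite inE mem_cat aF !orbT.
  have -> : Ordinal j_n = Ordinal i_n by apply: val_inj.
  have := eF (Ordinal i_n) _ rF; rewrite -L0_linked.1 ip_nrm.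
  move: (ip _ _) => z hz; have := nrm_sqr_close zeta1 hx (le_trans e20 e01).
  have := cmodD (z - (nrm (L0 x xi) ^+ 2)%:C) ((nrm (L0 x xi) ^+ 2)%:C - 1).
  rewrite addrA subrK -[X in cmod (_%:C - X)](rmorph1 (real_complex R)).
  rewrite -rmorphB cmodR; lra.
exists (fun i : 'I_n => w i) => [i j|i]; first by rewrite ww.
have w1 : nrm (w i) = 1.
  apply/eqP; rewrite -sqrp_eq1 ?nrm_ge0 // nrm_sqr ww // eqxx.
  by rewrite -(rmorph1 (real_complex R)).
apply/VecP; split=> //; apply: FN' => a aF.
rewrite /dual_app /= -/(dual_app psi a) psiE.
have aM := M_ge a aF.
have h1 := vector_state_close a w1 (wv i (ltn_ord i)) e01.
have h2 := vector_state_close a zeta1 hx (le_trans e20 e01).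
have raF : r (act a x) x \in F.
  rewrite inE mem_cat; apply/orP; right; apply/orP; left.
  by apply/mapP; exists a.
have := eF i _ raF.
rewrite -(linked_vector_state _ _ _ Ll) -(linked_vector_state _ _ _ L0_linked).
rewrite -vE => h3.
have Me := ler_wpM2r (ltW e0_gt0) aM.
have ae := ler_wpM2l (nrm_ge0 a) e20.
move: h1 h2 h3; move: (ip _ (w i)) (ip _ (v i)) (ip _ zeta) (ip _ (L0 x xi)).
move=> p q z q' h1 h2 h3.
(* The chain of states runs through [w i], [L x (e i)], [L0 x xi] and [zeta]. *)
have -> : p - z = (p - q) + (q - q') - (z - q') by ring.
have := cmodD ((p - q) + (q - q')) (- (z - q')); rewrite cmodN.
have := cmodD (p - q) (q - q'); lra.
Qed.

End Transfer.

(** * Comparison of lower multiplicities *)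

Section LowerMultiplicityComparison.
Variables (R : realType) (D : cstarType R) (phi : dual D).
Local Open Scope ereal_scope.

Lemma dVec_ge (t : rep D) (n : nat) (N : set (dual D)) :
  orthonormal_Vec t phi N n -> (n%:R)%:E <= dVec t phi N.
Proof. by move=> h; apply: ereal_sup_ubound; exists n. Qed.

Lemma dVec_gt (t : rep D) (n : nat) (N : set (dual D)) :
  (n%:R)%:E < dVec t phi N -> orthonormal_Vec t phi N n.+1.
Proof.
move=> /ereal_sup_gt[_ [m [e e_on eV] <-]]; rewrite lte_fin ltr_nat => nm.
exists (fun i => e (widen_ord nm i)) => [i j|i]; last exact: eV.
by rewrite e_on -!val_eqE.
Qed.

Lemma orthonormal_Vec0 (t : rep D) (N : set (dual D)) :
  orthonormal_Vec t phi N 0.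
Proof. by exists (fun=> 0%R) => [[]|[]]. Qed.

End LowerMultiplicityComparison.

(** The neighbourhood [N] depends on [n], and the values may be infinite. A strict inequality the
    other way makes the lower limit [l] for [N'] finite, so that a single integer [n + 1], with [n]
    the integer part of [l], has to be transferred. *)
Lemma lower_multiplicity_le (R : realType) (D E : cstarType R) (I : Type)
    (le : I -> I -> Prop) (t_ : I -> rep D) (t'_ : I -> rep E)
    (phi : dual D) (psi : dual E) :
  directed le ->
  (forall n N', weakstar_nbhs0 N' -> exists2 N, weakstar_nbhs0 N &
     forall i, orthonormal_Vec (t_ i) phi N n ->
       orthonormal_Vec (t'_ i) psi N' n) ->
  (lower_multiplicity phi le t_ <= lower_multiplicity psi le t'_)%E.
Proof.
move=> [[i0] le_refl _ _] h.
apply: le_ereal_inf_tmp => _ [N' /= N'0 <-].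
rewrite leNgt; apply/negP => lt.
set l := net_liminf _ _ in lt.
have liminf_ge i (n : nat) :
    (forall j, le i j -> orthonormal_Vec (t'_ j) psi N' n) ->
    ((n%:R)%:E <= l)%E.
  move=> hn; apply: le_trans (ereal_sup_ubound _); last by exists i.
  by apply: le_ereal_inf_tmp => _ [j /= ij <-]; apply/dVec_ge/hn.
have l0 : (0 <= l)%E.
  by have := liminf_ge i0 0%N; apply => j _; exact: orthonormal_Vec0.
have lfin : l \is a fin_num.
  by rewrite ge0_fin_numE //; apply: lt_le_trans lt (leey _).
have [n ln ln'] : exists2 n : nat, ((n%:R)%:E <= l)%E & (l < (n.+1%:R)%:E)%E.
  have := l0; rewrite -(fineK lfin) lee_fin => /truncn_itv /andP[h1 h2].
  by exists (Num.truncn (fine l)); rewrite ?lee_fin ?lte_fin.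
have [N N0 hN] := h n.+1 N' N'0.
have : ((n%:R)%:E < net_liminf le (fun i => dVec (t_ i) phi N))%E.
  apply: le_lt_trans ln _; apply: lt_le_trans lt _.
  by apply: ereal_inf_lbound; exists N.
move=> /ereal_sup_gt[_ [i _ <-] hi].
have := liminf_ge i n.+1; rewrite leNgt ln' => /(_ _)/negP; apply=> // j ij.
apply: hN; apply: dVec_gt; apply: lt_le_trans hi _.
by apply: ereal_inf_lbound; exists j.
Qed.

(** * Induced representations *)

Section Span.
Variables (R : realType) (V W : normedModType R[i]).

Lemma dense_span_eq0 (S : set V) (f : V -> W) (C : R) :
  closure (lin_span S) = setT -> linear f -> 0 <= C ->
  (forall v, nrm (f v) <= C * nrm v) -> (forall v, S v -> f v = 0) ->
  forall v, f v = 0.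
Proof.
move=> S_dense fl C0 fC fS v; apply: nrm_small0 => e e0.
have C1 : 0 < C + 1 by lra.
have /closure_nrmP/(_ _ (divr_gt0 e0 C1))[u [n [c [s [sS uE]]]] uv] :
  closure (lin_span S) v by rewrite S_dense.
have fu : f u = 0.
  rewrite uE; elim/big_ind: _ => [|x y fx fy|i _]; first exact: linear_map0.
  - by rewrite linear_mapD // fx fy addr0.
  - by rewrite linear_mapZ // fS // scaler0.
rewrite -[f v]subr0 -fu -linear_mapB //; apply: le_trans (fC _) _.
move: uv; rewrite ltr_pdivlMr //; have := nrm_ge0 (v - u); lra.
Qed.

End Span.

Section Induction.
Variables (R : realType) (A B : cstarType R) (X : imprimitivity_bimodule A B).

Section Tensors.
Variables (s : rep B) (k_ : induced_rep X s).
Notation H := (rep_space s).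
Notation K := (rep_space k_).
Implicit Types (x y z : bim_space X) (g h : H) (k l : K).

(** The natural constant is the square root of [nrm (rip x x)]; adding 1 to the norm dominates it
    without a root. *)
Lemma tens_bounded x h :
  nrm (tens k_ x h) <= (nrm (rip x x) + 1) * nrm h.
Proof.
have h1 : nrm (tens k_ x h) ^+ 2 <= nrm (rip x x) * nrm h ^+ 2.
  rewrite nrm_sqr tens_ip; apply: le_trans (ler_norm _) _.
  apply: le_trans (Re_le_cmod _) _.
  apply: le_trans (cauchy_schwarz _ _) _.
  by rewrite expr2 mulrA ler_wpM2r ?nrm_ge0 // rep_contractive.
have r0 := nrm_ge0 (rip x x).
rewrite -ler_sqr ?nnegrE ?mulr_ge0 ?addr_ge0 ?nrm_ge0 //.
apply: le_trans h1 _; rewrite exprMn ler_wpM2r ?sqr_ge0 //; nra.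
Qed.

Lemma tens_ext k l :
  (forall x h, ip (tens k_ x h) k = ip (tens k_ x h) l) -> k = l.
Proof.
move=> kl; apply: ip_ext => m; rewrite ipC [RHS]ipC; congr (Num.conj _).
apply/eqP; rewrite -subr_eq0 -ipBr; apply/eqP.
apply: (@dense_span_eq0 R K R[i]^o _ (fun v => ip v (k - l)) (nrm (k - l))
  (tens_dense k_)) => [c u v||v|_ [[x h] _ <-]].
- by rewrite ipPl.
- exact: nrm_ge0.
- by rewrite mulrC; exact: cauchy_schwarz.
- by rewrite /= ipBr kl subrr.
Qed.

Lemma tens_adjoint : exists L : bim_space X -> K -> H,
  forall x h k, ip (tens k_ x h) k = ip h (L x k).
Proof.
have /choice[L LP] (p : bim_space X * K) :
    exists m : H, forall h, ip (tens k_ p.1 h) p.2 = ip h m.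
  apply: (@riesz R H H idfun _ ((nrm (rip p.1 p.1) + 1) * nrm p.2)) => //.
    by move=> c u v; rewrite linearPr ipPl.
  move=> h /=; apply: le_trans (cauchy_schwarz _ _) _.
  by rewrite mulrAC ler_wpM2r ?nrm_ge0 // tens_bounded.
by exists (fun x k => L (x, k)) => x h k; exact: (LP (x, k)).
Qed.

Lemma tens_linked : linked (fun x y => rip y x) (lact X) (tens k_).
Proof. by split=> *; [exact: tens_ip|exact: ind_act]. Qed.

Section Adjoint.
Variable L : bim_space X -> K -> H.
Hypothesis LP : forall x h k, ip (tens k_ x h) k = ip h (L x k).

(** Paired with [z (x) h], this is the compatibility of the two inner products,
    [x <y, z>_B = <x, y>_A z]. It is what makes the adjoints [L x] behave like tensors. *)
Lemma tens_tens_adjoint x y k : tens k_ y (L x k) = rep_act k_ (lip y x) k.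
Proof.
have [_ _ _ lipC _ _ _] := bim_left X.
have [_ _ _ ripC _ _ _] := bim_right X.
apply: tens_ext => z h; rewrite tens_ip -LP -tens_balanced -bim_compat.
by rewrite -ind_act rep_star lipC.
Qed.

(** As [L x] is conjugate linear in [x], the module in play is the conjugate of X, on which [b] acts
    on the left by [x |-> x b^*]. *)
Lemma tens_adjoint_linked :
  linked (fun x y => lip y x) (fun b x => ract X x (cstar b)) L.
Proof.
split=> [x k y l|b x k]; first by rewrite -LP tens_tens_adjoint.
apply: ip_ext => h; rewrite ipC [RHS]ipC; congr (Num.conj _).
by rewrite rep_adjoint -LP -tens_balanced LP.
Qed.

Lemma tens_adjoint_conj_linear c x y k :
  L (c *: x + y) k = Num.conj c *: L x k + L y k.
Proof.
apply: ip_ext => h; rewrite ipC [RHS]ipC; congr (Num.conj _).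
by rewrite -LP linearPl ipPl ipPr conjCK !LP.
Qed.

Lemma tens_adjoint_dense k : irreducible s -> k <> 0 ->
  dense_family (fun x => L x k).
Proof.
move=> s_irr k0 h e e0.
have [||||_ [x _ <-] hx] := @irreducible_dense _ _ _ s_irr (range (L ^~ k))
  _ _ _ _ h e e0; last by exists x.
- exists 0 => //; apply: ip_ext => h'.
  by rewrite ipC -LP linear0l !ip0l rmorph0.
- move=> c _ _ [x _ <-] [y _ <-]; exists (Num.conj c *: x + y) => //.
  by rewrite tens_adjoint_conj_linear conjCK.
- move=> b _ [x _ <-]; exists (ract X x (cstar b)) => //.
  by rewrite tens_adjoint_linked.2.
- apply: contrapT => no; apply: k0; apply: tens_ext => x h'.
  rewrite LP ip0r; have [->|Lx] := pselect (L x k = 0); first by rewrite ip0r.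
  by case: no; exists (L x k) => //; exists x.
Qed.

End Adjoint.

Lemma rip_rep_eq0 h : (forall x y, rep_act s (rip y x) h = 0) ->
  forall b, rep_act s b h = 0.
Proof.
move=> h0; apply: (@dense_span_eq0 R B H _ (rep_act s ^~ h) (nrm h)
  (bim_right_full X)) => [||b|_ [[y x] _ <-]].
- exact: rep_linear_l.
- exact: nrm_ge0.
- by rewrite mulrC; exact: rep_contractive.
- exact: h0.
Qed.

Lemma tens_eq0 h : irreducible s -> (forall x, tens k_ x h = 0) -> h = 0.
Proof.
move=> s_irr h0; apply: (irreducible_nondegenerate s_irr); apply: rip_rep_eq0.
move=> x y; apply: ip_ext => g.
by rewrite -(tens_ip k_ x h y g) h0 !ip0l.
Qed.

Lemma induced_irreducible : irreducible s -> irreducible k_.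
Proof.
move=> s_irr; split.
  have [[b [h /eqP bh]] _] := s_irr.
  have h_neq0 : h <> 0 by move=> h0; apply: bh; rewrite h0 linear0r.
  apply: contrapT => no.
  have act0 a k : rep_act k_ a k = 0.
    by apply: contrapT => /eqP ak; apply: no; exists a, k.
  (* By balancing and compatibility, [x (x) <y, z>_B g = <x, y>_A (z (x) g)]; fullness then makes
     all of B annihilate [h]. *)
  have t0 x y z g : tens k_ x (rep_act s (rip y z) g) = 0.
    by rewrite -tens_balanced -bim_compat -ind_act act0.
  apply: h_neq0; apply: (irreducible_nondegenerate s_irr); apply: rip_rep_eq0.
  by move=> x y; apply: (tens_eq0 s_irr) => z; exact: t0.
move=> V [Vc V0 Vl] Vact.
have [L LP] := tens_adjoint.
(* The invariant subspace [V] is pulled back to the invariant subspace [U], on which irreducibility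
   of [s] applies. *)
pose U := [set h : H | forall x, V (tens k_ x h)].
have Uc : closed_subspace U.
  split=> [|x|c u v Uu Uv x]; last 2 first.
  - by rewrite linear0r.
  - by rewrite linearPr; apply: Vl.
  apply/closed_nrmP => h hU x; move/closed_nrmP: Vc; apply=> e e0.
  have C1 : 0 < nrm (rip x x) + 1 by rewrite ltr_wpDl ?nrm_ge0.
  have [u Uu hu] := hU _ (divr_gt0 e0 C1).
  exists (tens k_ x u); first exact: Uu.
  rewrite -linearBr; apply: le_lt_trans (tens_bounded _ _) _.
  by move: hu; rewrite ltr_pdivlMr // mulrC.
have [|U0|UT] := s_irr.2 U Uc.
- by move=> b h Uh x; rewrite -tens_balanced; exact: Uh.
(* For [k] in [V], every [y (x) L x k] is [<y, x>_A k], again in [V]. So [L x k] lies in [U = 0],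
   and [k] is orthogonal to all tensors. *)
- left; apply/seteqP; split=> [k Vk|_ -> //]; apply: tens_ext => x h.
  rewrite LP ip0r; suff -> : L x k = 0 by rewrite ip0r.
  have : U (L x k) by move=> y; rewrite (tens_tens_adjoint LP); exact: Vact.
  by rewrite U0.
- right; apply/seteqP; split=> // k _.
  have : closure (lin_span
    [set tens k_ p.1 p.2 | p in [set: bim_space X * H]]) k.
    by rewrite tens_dense.
  move=> /closure_nrmP kS; move/closed_nrmP: Vc; apply=> e.
  move=> /kS[u [n [c [v [vS ->]]]] ku].
  exists (\sum_(i < n) c i *: v i) => //.
  elim/big_ind: _ => [//|x y Vx Vy|i _].
    by have := Vl 1 _ _ Vx Vy; rewrite scale1r.
  have [[x h] _ <-] := vS i; rewrite -[X in V X]addr0; apply: Vl V0.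
  by have : U h by rewrite UT.
Qed.

Lemma tens_dense_family h : irreducible s -> h <> 0 ->
  dense_family (fun x => tens k_ x h).
Proof.
move=> s_irr h0 k e e0.
have [||||_ [x _ <-] hx] := @irreducible_dense _ _ _ (induced_irreducible s_irr)
  (range (tens k_ ^~ h)) _ _ _ _ k e e0; last by exists x.
- by exists 0 => //; rewrite linear0l.
- move=> c _ _ [x _ <-] [y _ <-]; exists (c *: x + y) => //.
  exact: linearPl.
- by move=> a _ [x _ <-]; exists (lact X a x) => //; rewrite ind_act.
- apply: contrapT => no; apply: h0; apply: (tens_eq0 s_irr) => x.
  by apply: contrapT => Lx; apply: no; exists (tens k_ x h) => //; exists x.
Qed.

End Tensors.
End Induction.

Theorem corollary12 (R : realType) (A B : cstarType R)
    (X : imprimitivity_bimodule A B)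
    (I : Type) (le : I -> I -> Prop) (le_directed : directed le)
    (pi : irrep B) (pi_ : I -> irrep B)
    (pi_cluster : spectrum_cluster le pi_ pi)
    (ind_pi : induced_rep X pi)
    (ind_pi_ : forall i, induced_rep X (pi_ i))
    (phi : dual B) (phi_pi : vector_state pi phi)
    (psi : dual A) (psi_ind_pi : vector_state ind_pi psi) :
  lower_multiplicity phi le pi_ = lower_multiplicity psi le ind_pi_.
Proof.
have [xi [xi1 phiE]] := vector_state_nrm phi_pi.
have [zeta [zeta1 psiE]] := vector_state_nrm psi_ind_pi.
have pi_irr := irrepP pi.
have ind_irr := induced_irreducible ind_pi pi_irr.
apply/eqP; rewrite eq_le; apply/andP; split;
    apply: lower_multiplicity_le => // n N' N'0.
  have dns := @tens_dense_family _ _ _ _ _ ind_pi _ pi_irr (unit_neq0 xi1).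
  have [N N0 hN] := transfer_orthonormal_Vec pi_irr (tens_linked ind_pi)
    xi1 zeta1 dns phiE psiE n N'0.
  by exists N => // i; apply: hN; exact: tens_linked.
have [L LP] := tens_adjoint ind_pi.
have dns := tens_adjoint_dense LP pi_irr (unit_neq0 zeta1).
have [N N0 hN] := transfer_orthonormal_Vec ind_irr (tens_adjoint_linked LP)
  zeta1 xi1 dns psiE phiE n N'0.
exists N => // i; have [Li LiP] := tens_adjoint (ind_pi_ i).
by apply: hN; exact: tens_adjoint_linked LiP.
Qed.
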